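(* Let $\Omega$ be a simply connected bounded domain in $\mathbb{R}^2$, and let $\bar x,\bar y\in\Omega$. There exists a finite family $\{S_1,S_2,\dots,S_k\}$ of pairwise disjoint squares in $\Omega$ such that: (i) $\bar x\in S_1$ and $\bar y\in S_k^{\mathrm{cl}}$; (ii) $S_i^{\mathrm{cl}}\cap S_{i+1}^{\mathrm{cl}}\cap\Omega\ne\emptyset$ for all $i=1,\dots,k-1$, but $S_i^{\mathrm{cl}}\cap S_j^{\mathrm{cl}}\cap\Omega=\emptyset$ for all $1\le i,j\le k$ such that $|i-j|>1$; (iii) for every $i=2,\dots,k-1$ the open set $\Omega\setminus S_i^{\mathrm{cl}}$ is not connected, and the sets $\bigcup_{j<i}S_j$ and $\bigcup_{j>i}S_j$ belong to distinct connected components of $\Omega\setminus S_i^{\mathrm{cl}}$.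
   Context: A domain is an open connected set. ''Square'' means an open square in $\mathbb{R}^2$ whose sides are parallel to the coordinate axes. $E^{\mathrm{cl}}$ denotes the closure of a set $E\subset\mathbb{R}^2$. *)

(* Defs.v *)
From HB Require Import structures.
From mathcomp Require Import all_boot all_order all_algebra.
From mathcomp Require Import all_classical all_reals all_analysis.
Import Order.TTheory GRing.Theory Num.Theory.
Import numFieldNormedType.Exports.

Set Implicit Arguments.
Unset Strict Implicit.
Unset Printing Implicit Defensive.

Local Open Scope classical_set_scope.
Local Open Scope ring_scope.

(* The plane is R * R; its product topology, and the boundedness given by its
   max norm, are the Euclidean ones. *)

Definition domain (R : realType) (W : set (R * R)) : Prop :=
  open W /\ connected W.

Definition path_in (R : realType) (T : topologicalType) (A : set T) (x y : T)
    (g : R -> T) : Prop :=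
  [/\ {within `[0, 1], continuous g}, g @` `[0, 1] `<=` A, g 0 = x & g 1 = y].

(* H (s, t) is at time s in the deformation and at parameter t on the loop. *)
Definition null_homotopic_in (R : realType) (T : topologicalType) (A : set T)
    (x : T) (g : R -> T) : Prop :=
  exists H : R * R -> T,
    [/\ {within `[0, 1] `*` `[0, 1], continuous H},
        H @` (`[0, 1] `*` `[0, 1]) `<=` A,
        forall t, t \in `[0, 1] -> H (0, t) = g t,
        forall t, t \in `[0, 1] -> H (1, t) = x &
        forall s, s \in `[0, 1] -> H (s, 0) = x /\ H (s, 1) = x].

Definition simply_connected (R : realType) (A : set (R * R)) : Prop :=
  (forall x y, A x -> A y -> exists g : R -> R * R, path_in A x y g) /\
  (forall x (g : R -> R * R), path_in A x x g -> null_homotopic_in A x g).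

Definition square (R : realType) (Q : set (R * R)) : Prop :=
  exists a b s : R, 0 < s /\ Q = `]a, a + s[ `*` `]b, b + s[.

Definition is_component (T : topologicalType) (A C : set T) : Prop :=
  exists2 x, A x & C = connected_component A x.

(* Main.v *)
Require Import Defs.
From HB Require Import structures.
From mathcomp Require Import all_boot all_order all_algebra.
From mathcomp Require Import all_classical all_reals all_analysis.
From mathcomp Require Import zify ring lra.
Import Order.TTheory GRing.Theory Num.Theory.
Import numFieldNormedType.Exports.

Set Implicit Arguments.
Unset Strict Implicit.
Unset Printing Implicit Defensive.

Local Open Scope classical_set_scope.
Local Open Scope ring_scope.

(* Squares are balls of the max norm.  The key step is the square separation
   theorem: if a square S in Omega touches the boundary of Omega at a, and y
   is in Omega off the closure of S, then some square Q in Omega touches S from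
   outside inside Omega, touches the boundary of Omega, and its closure contains
   y or separates y from S.  To see this, slide the contact point along the
   boundary of S, keeping Q maximal.  If Q never works, then y is always
   connected, off S and Q, to the part of the boundary of S on the left or on
   the right of the contact point.  It cannot be both: the broken line from a
   through the centres of S and Q to a boundary point on Q is a crosscut, which
   separates because a square root of (w - a) / (w - z) is single-valued on Omega
   but changes sign across the line.  Both alternatives are open conditions, so
   one of them persists until the contact point leaves Omega; there the squares
   shrink and this becomes absurd.

   Starting from the maximal square centred at x and iterating gives the chain.
   Since a square has only one side locally, the component of y off the i-th
   closed square decreases with i and contains all later squares.  The chain
   stops because each square meets a fixed compact connected set joining x to y
   and also touches the boundary of Omega, so that the sizes of these disjoint
   squares are bounded below. *)

(** * Square roots up to positive factors *)

(** Null-homotopic loops give single-valued square roots of nonvanishing functions, and one sign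
    already tells the two sides of a crosscut apart; neither winding numbers nor the Jordan curve
    theorem enters. Roots are taken up to positive factors because z + |z| and z conj(w) are then
    explicit, continuous everywhere, and free of divisions and arguments. The obstacle in the slide
    is that the maximal radius may jump as the contact point moves. Only half of continuity holds:
    nearby tangent squares lie in a slight enlargement of the given one. This suffices because
    connections are kept as compact sets, which have room around them. Near the first contact point
    [b] outside the domain the squares may also stay large. Here squares differ from round discs: a
    large one touching near [b] contains [b] and the contact points in between, although [y] is
    still reached at one of these. *)

Lemma connected_two_open (T : topologicalType) (E U V : set T) (x : T) :
  connected E -> open U -> open V -> E `<=` U `|` V -> E `&` U `&` V = set0 ->
  E x -> U x -> E `<=` U.
Proof.
move=> cE oU oV EUV dis Ex Ux.
have <- : E `&` U = E; last by move=> ? [].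
apply: cE; first by exists x.
- by exists U.
- exists (~` V); first exact: open_closedC.
  apply/seteqP; split=> z [Ez].
    by move=> Uz; split=> // Vz; have : set0 z by rewrite -dis.
  by move=> nVz; split=> //; have [] := EUV z Ez.
Qed.

Section ComplexPlane.
Variable R : realType.
Notation C := (R * R)%type.
Implicit Types (z w u v : C) (k t s : R).

Definition cmul z w : C := (z.1 * w.1 - z.2 * w.2, z.1 * w.2 + z.2 * w.1).
Definition cconj z : C := (z.1, - z.2).
Definition rdot z w : R := z.1 * w.1 + z.2 * w.2.
Definition cross z w : R := z.1 * w.2 - z.2 * w.1.
Definition nrm2 z : R := Num.sqrt (z.1 ^+ 2 + z.2 ^+ 2).

(* For z off the half-line (-oo, 0], z + |z| is a positive multiple of the
   principal square root of z; on that half-line it vanishes. *)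
Definition half_dir z : C := (z.1 + nrm2 z, z.2).

(* [v] is a square root of [z] up to a positive factor. *)
Definition branch z v := v != 0 /\ exists2 k, 0 < k & cmul v v = k *: z.

Lemma pair_ext z w : z.1 = w.1 -> z.2 = w.2 -> z = w.
Proof. by case: z w => [a b] [c d] /= -> ->. Qed.

Lemma scale_pairE k z : k *: z = (k * z.1, k * z.2).
Proof. by []. Qed.

Lemma sqr_sum_gt0 z : z != 0 -> 0 < z.1 ^+ 2 + z.2 ^+ 2.
Proof.
move=> z0; rewrite lt0r paddr_eq0 ?sqr_ge0// !sqrf_eq0 addr_ge0 ?sqr_ge0// andbT.
by apply: contra z0 => /andP[/eqP a /eqP b]; apply/eqP/pair_ext.
Qed.

Lemma cmul_neq0 z w : (cmul z w != 0) = (z != 0) && (w != 0).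
Proof.
apply/idP/andP => [h|[z0 w0]].
  by split; apply: contra h => /eqP ->; apply/eqP/pair_ext => /=; ring.
apply: contraTneq (mulr_gt0 (sqr_sum_gt0 z0) (sqr_sum_gt0 w0)) => -[/= e1 e2].
have -> : (z.1 ^+ 2 + z.2 ^+ 2) * (w.1 ^+ 2 + w.2 ^+ 2) =
  (z.1 * w.1 - z.2 * w.2) ^+ 2 + (z.1 * w.2 + z.2 * w.1) ^+ 2 by ring.
by rewrite e1 e2 expr0n addr0 ltxx.
Qed.

Lemma cconj_neq0 z : z != 0 -> cconj z != 0.
Proof.
by apply: contra => /eqP[a /eqP]; rewrite oppr_eq0 => /eqP b; apply/eqP/pair_ext.
Qed.

Lemma sqr_nrm2 z : nrm2 z ^+ 2 = z.1 ^+ 2 + z.2 ^+ 2.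
Proof. by rewrite sqr_sqrtr// addr_ge0 ?sqr_ge0. Qed.

Lemma nrm2_ge0 z : 0 <= nrm2 z. Proof. exact: sqrtr_ge0. Qed.

Lemma normr1_le_nrm2 z : `|z.1| <= nrm2 z.
Proof. by rewrite -sqrtr_sqr ler_wsqrtr// lerDl sqr_ge0. Qed.

(** Up to positive factors, all that remains of the choice of a root is a sign; the monodromy
    argument compares such signs. *)
Lemma branch_proportional z u v : branch z u -> branch z v ->
  exists2 c : R, c != 0 & u = c *: v.
Proof.
move=> [u0 [k k0 [e1 e2]]] [v0 [l l0 [f1 f2]]].
have [u1 v1] := (sqr_sum_gt0 u0, sqr_sum_gt0 v0).
set d := rdot u v / (v.1 ^+ 2 + v.2 ^+ 2).
have kl : 0 < k / l by rewrite divr_gt0.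
have g1 : u.1 * u.1 - u.2 * u.2 = k / l * (v.1 * v.1 - v.2 * v.2).
  by rewrite f1 /= e1 -mulrA (mulrA l^-1) mulVf ?gt_eqF// mul1r.
have g2 : u.1 * u.2 + u.2 * u.1 = k / l * (v.1 * v.2 + v.2 * v.1).
  by rewrite f2 /= e2 -mulrA (mulrA l^-1) mulVf ?gt_eqF// mul1r.
(* u^2 is a positive multiple of v^2, so u conj(v) has a positive square *)
have h1 : 2 * cross u v * rdot u v = 0.
  have -> : 2 * cross u v * rdot u v =
    (u.1 * u.1 - u.2 * u.2) * (v.1 * v.2 + v.2 * v.1) -
    (u.1 * u.2 + u.2 * u.1) * (v.1 * v.1 - v.2 * v.2) by rewrite /cross /rdot; ring.
  by rewrite g1 g2; ring.
have h2 : 0 < rdot u v ^+ 2 - cross u v ^+ 2.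
  have -> : rdot u v ^+ 2 - cross u v ^+ 2 =
    (u.1 * u.1 - u.2 * u.2) * (v.1 * v.1 - v.2 * v.2) +
    (u.1 * u.2 + u.2 * u.1) * (v.1 * v.2 + v.2 * v.1) by rewrite /cross /rdot; ring.
  rewrite g1 g2.
  set K := k / l; have -> : K * (v.1 * v.1 - v.2 * v.2) * (v.1 * v.1 - v.2 * v.2) +
    K * (v.1 * v.2 + v.2 * v.1) * (v.1 * v.2 + v.2 * v.1) =
    K * (v.1 ^+ 2 + v.2 ^+ 2) ^+ 2 by ring.
  by rewrite mulr_gt0// exprn_gt0.
have h3 : rdot u v != 0.
  by apply: contraTneq h2 => ->; rewrite -leNgt expr0n sub0r oppr_le0 sqr_ge0.
have h4 : cross u v = 0 by move/eqP: h1; rewrite !mulf_eq0 pnatr_eq0 (negbTE h3) orbF => /eqP.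
exists d; first by rewrite /d mulf_neq0// invr_eq0 gt_eqF.
have dE : d * (v.1 ^+ 2 + v.2 ^+ 2) = rdot u v by rewrite /d mulfVK// gt_eqF.
apply: pair_ext => /=; apply: (mulIf (lt0r_neq0 v1)); rewrite [RHS]mulrAC dE;
  move: h4; rewrite /cross /rdot => h4.
  have -> : u.1 * (v.1 ^+ 2 + v.2 ^+ 2) = (u.1 * v.1 + u.2 * v.2) * v.1 + (u.1 * v.2 - u.2 * v.1) * v.2 by ring.
  by rewrite h4 mul0r addr0.
have -> : u.2 * (v.1 ^+ 2 + v.2 ^+ 2) = (u.1 * v.1 + u.2 * v.2) * v.2 - (u.1 * v.2 - u.2 * v.1) * v.1 by ring.
by rewrite h4 mul0r subr0.
Qed.

Lemma branchZ z v c : c != 0 -> branch z v -> branch z (c *: v).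
Proof.
move=> c0 [v0 [k k0 e]]; split; first by rewrite scaler_eq0 negb_or c0.
exists (c ^+ 2 * k); first by rewrite mulr_gt0// exprn_even_gt0.
by rewrite -scalerA -e !scale_pairE; apply: pair_ext => /=; ring.
Qed.

Lemma branchM z w u v : branch z u -> branch w v -> branch (cmul z w) (cmul u v).
Proof.
move=> [u0 [k k0 [e1 e2]]] [v0 [l l0 [f1 f2]]]; split; first by rewrite cmul_neq0 u0.
exists (k * l); first exact: mulr_gt0.
have -> : cmul (cmul u v) (cmul u v) = cmul (cmul u u) (cmul v v).
  by apply: pair_ext => /=; ring.
have -> : cmul u u = k *: z by apply: pair_ext.
have -> : cmul v v = l *: w by apply: pair_ext.
by rewrite !scale_pairE; apply: pair_ext => /=; ring.
Qed.

Lemma branch_conj z v : branch z v -> branch (cconj z) (cconj v).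
Proof.
move=> [v0 [k k0 [e1 e2]]]; split; first exact: cconj_neq0.
have f1 : v.1 * v.1 - v.2 * v.2 = k * z.1 := e1.
have f2 : v.1 * v.2 + v.2 * v.1 = k * z.2 := e2.
by exists k => //; rewrite scale_pairE; apply: pair_ext => /=; rewrite ?mulrN -?f1 -?f2; ring.
Qed.

Lemma branch_scaled z k v : 0 < k -> branch (k *: z) v -> branch z v.
Proof.
move=> k0 [v0 [l l0 e]]; split => //; exists (l * k); first exact: mulr_gt0.
by rewrite e scalerA.
Qed.

Lemma half_dir_neq0 z : z != 0 -> ~~ ((z.2 == 0) && (z.1 <= 0)) -> half_dir z != 0.
Proof.
move=> z0; apply: contra => /eqP[e1 e2]; rewrite /= in e1 e2.
rewrite e2 eqxx /=; have := nrm2_ge0 z; lra.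
Qed.

Lemma half_dir_branch z : half_dir z != 0 -> branch z (half_dir z).
Proof.
move=> h0; split=> //.
have n2 := sqr_nrm2 z; have nz := normr1_le_nrm2 z.
(* From |z|^2 = z conj(z): (z + |z|)^2 = z (z + 2 |z| + conj(z)) = 2 (|z| + Re z) z. *)
exists (2 * (nrm2 z + z.1)).
  rewrite mulr_gt0// lt0r; apply/andP; split; last first.
    by move: nz; rewrite ler_norml => /andP[nz _]; rewrite addrC -lerBlDr sub0r.
  apply: contra h0 => /eqP e; have z1 : nrm2 z = - z.1 by lra.
  have z2 : z.2 ^+ 2 = 0 by move: n2; rewrite z1; nra.
  move/eqP: z2; rewrite sqrf_eq0 => /eqP z2.
  by apply/eqP; apply: pair_ext => //=; rewrite z1 subrr.
rewrite scale_pairE; apply: pair_ext => /=; nra.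
Qed.

Lemma half_dir_eq0 z : half_dir z = 0 -> z.2 = 0 /\ z.1 <= 0.
Proof. by move=> [e1 e2]; split=> //; have := nrm2_ge0 z; lra. Qed.

Lemma branch_trivial z : 0 < z.1 -> z.2 = 0 -> branch z (1, 0).
Proof.
move=> z1 z2; split; first by apply/eqP => -[]/eqP; rewrite oner_eq0.
exists z.1^-1; first by rewrite invr_gt0.
by rewrite scale_pairE; apply: pair_ext; rewrite /= ?z2 ?mulVf ?gt_eqF//; ring.
Qed.

End ComplexPlane.

Ltac plane_ring := rewrite ?scale_pairE; apply: pair_ext => /=; ring.

(** * Continuity of planar operations, and clamping to the unit interval *)

Section Continuity.
Variables (R : realType) (T : topologicalType).
Notation C := (R * R)%type.

Lemma continuous_forP (U : topologicalType) (f : T -> U) :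
  (forall x, {for x, continuous f}) -> continuous f.
Proof. by []. Qed.

Lemma continuous_pair (f g : T -> R) x :
  {for x, continuous f} -> {for x, continuous g} ->
  {for x, continuous (fun y => (f y, g y) : C)}.
Proof. by move=> cf cg; exact: (cvg_pair cf cg). Qed.

Lemma continuous_fst (f : T -> C) x :
  {for x, continuous f} -> {for x, continuous (fun y => (f y).1)}.
Proof. by move=> cf; apply: (continuous_comp cf); exact: cvg_fst. Qed.

Lemma continuous_snd (f : T -> C) x :
  {for x, continuous f} -> {for x, continuous (fun y => (f y).2)}.
Proof. by move=> cf; apply: (continuous_comp cf); exact: cvg_snd. Qed.

Lemma continuous_cmul (f g : T -> C) x :
  {for x, continuous f} -> {for x, continuous g} ->
  {for x, continuous (fun y => cmul (f y) (g y))}.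
Proof.
move=> cf cg; apply: continuous_pair.
  apply: cvgB; (apply: cvgM;
  [exact: continuous_fst || exact: continuous_snd|exact: continuous_fst || exact: continuous_snd]).
apply: cvgD; (apply: cvgM;
  [exact: continuous_fst || exact: continuous_snd|exact: continuous_fst || exact: continuous_snd]).
Qed.

Lemma continuous_rdot (f g : T -> C) x :
  {for x, continuous f} -> {for x, continuous g} ->
  {for x, continuous (fun y => rdot (f y) (g y))}.
Proof.
move=> cf cg; apply: cvgD; (apply: cvgM;
  [exact: continuous_fst || exact: continuous_snd|exact: continuous_fst || exact: continuous_snd]).
Qed.

Lemma continuous_cconj (f : T -> C) x :
  {for x, continuous f} -> {for x, continuous (fun y => cconj (f y))}.
Proof.
by move=> cf; apply: continuous_pair; [exact: continuous_fst|apply: cvgN; exact: continuous_snd].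
Qed.

Lemma continuous_half_dir (f : T -> C) x :
  {for x, continuous f} -> {for x, continuous (fun y => half_dir (f y))}.
Proof.
move=> cf; apply: continuous_pair; last exact: continuous_snd.
apply: cvgD; first exact: continuous_fst.
apply: (@continuous_comp _ _ _ (fun y => (f y).1 ^+ 2 + (f y).2 ^+ 2) Num.sqrt); last exact: sqrt_continuous.
by apply: cvgD; apply: cvgM; (exact: continuous_fst || exact: continuous_snd).
Qed.

End Continuity.

Section Paths.
Variable R : realType.
Notation C := (R * R)%type.
Implicit Types (z w u v : C) (k t s : R).

(** Precomposition with [clamp] turns continuity within [0, 1] into continuity on the whole line, so
    that paths and homotopies become total continuous maps. *)
Definition clamp t : R := Num.max 0 (Num.min 1 t).

Lemma clamp_itv t : 0 <= clamp t <= 1.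
Proof.
rewrite /clamp le_max lexx/= ge_max ler01/= ge_min lexx//.
Qed.

Lemma clamp_id t : 0 <= t <= 1 -> clamp t = t.
Proof. by move=> /andP[t0 t1]; rewrite /clamp min_r// max_r. Qed.

Lemma clamp_le0 t : t <= 0 -> clamp t = 0.
Proof. by move=> t0; rewrite /clamp max_l// ge_min t0 orbT. Qed.

Lemma clamp_ge1 t : 1 <= t -> clamp t = 1.
Proof. by move=> t1; rewrite /clamp min_l// max_r. Qed.

Lemma continuous_clamp : continuous clamp.
Proof.
move=> t; apply: (@continuous_max R _ (fun=> 0)); first exact: cst_continuous.
by apply: (@continuous_min R _ (fun=> 1) id); [exact: cst_continuous|exact: cvg_id].
Qed.

End Paths.

(** * Square roots along loops in a simply connected domain *)

Section Monodromy.
Variable R : realType.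
Notation C := (R * R)%type.
Implicit Types (z w u v : C) (k t s : R) (Om : set C) (F : C -> C).

(* Continuing a branch of the square root of [F] (up to a positive factor) along a path. *)
Definition continues Om F w v w' v' := exists g l : R -> C,
  [/\ continuous g, continuous l, g 0 = w /\ l 0 = v, g 1 = w' /\ l 1 = v' &
      forall t, 0 <= t <= 1 -> Om (g t) /\ branch (F (g t)) (l t)].

Lemma continues_sym Om F w v w' v' :
  continues Om F w v w' v' -> continues Om F w' v' w v.
Proof.
move=> [g [l [cg cl [g0 l0] [g1 l1] H]]].
have cr : continuous (fun t : R => 1 - t).
  by move=> t; apply: cvgB; [exact: cvg_cst|exact: cvg_id].
exists (fun t => g (1 - t)), (fun t => l (1 - t)); split.
- by move=> t; apply: (continuous_comp (cr t)); exact: cg.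
- by move=> t; apply: (continuous_comp (cr t)); exact: cl.
- by rewrite subr0.
- by rewrite subrr.
- by move=> t t01; apply: H; lra.
Qed.

Lemma continuous_concat (g h : R -> C) : continuous g -> continuous h ->
  continuous (fun t => g (clamp (2 * t)) + h (clamp (2 * t - 1)) - h 0).
Proof.
move=> cg ch t; apply: cvgB; last exact: cvg_cst.
have c2 : {for t, continuous (fun t : R => 2 * t)}.
  by apply: cvgM; [exact: cvg_cst|exact: cvg_id].
apply: cvgD.
  apply: (@continuous_comp _ _ _ (fun t => clamp (2 * t)) g); last exact: cg.
  by apply: (continuous_comp c2); exact: continuous_clamp.
apply: (@continuous_comp _ _ _ (fun t => clamp (2 * t - 1)) h); last exact: ch.
apply: (@continuous_comp _ _ _ (fun t : R => 2 * t - 1) (@clamp R)).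
  by apply: cvgB; [exact: c2|exact: cvg_cst].
exact: continuous_clamp.
Qed.

Lemma continues_trans Om F w v w' v' w'' v'' :
  continues Om F w v w' v' -> continues Om F w' v' w'' v'' ->
  continues Om F w v w'' v''.
Proof.
move=> [g [l [cg cl [g0 l0] [g1 l1] H]]] [g' [l' [cg' cl' [g0' l0'] [g1' l1'] H']]].
exists (fun t => g (clamp (2 * t)) + g' (clamp (2 * t - 1)) - g' 0),
  (fun t => l (clamp (2 * t)) + l' (clamp (2 * t - 1)) - l' 0).
have c0 : clamp (2 * 0 : R) = 0 by apply: clamp_le0; lra.
have c0' : clamp (2 * 0 - 1 : R) = 0 by apply: clamp_le0; lra.
have c1 : clamp (2 * 1 : R) = 1 by apply: clamp_ge1; lra.
have c1' : clamp (2 * 1 - 1 : R) = 1 by apply: clamp_ge1; lra.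
split.
- exact: continuous_concat.
- exact: continuous_concat.
- by rewrite c0 c0' !addrK.
- by rewrite c1 c1' g1 l1 g1' l1' g0' l0' !(addrC w') !(addrC v') !addrK.
- move=> t t01; have [t2|t2] := lerP (2 * t) 1.
    rewrite (@clamp_le0 _ (2 * t - 1)); last lra.
    by rewrite !addrK; apply: H; exact: clamp_itv.
  rewrite (@clamp_ge1 _ (2 * t)); last lra.
  rewrite g1 l1 g0' l0' !(addrC w') !(addrC v') !addrK; apply: H'; exact: clamp_itv.
Qed.

Lemma continues_scale Om F w v k : Om w -> branch (F w) v -> 0 < k ->
  continues Om F w v w (k *: v).
Proof.
move=> Ow bv k0; exists (fun=> w), (fun t => ((1 + t * (k - 1)) * v.1, (1 + t * (k - 1)) * v.2)); split.
- by move=> t; exact: cvg_cst.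
- move=> t; have c : {for t, continuous (fun t => 1 + t * (k - 1))}.
    apply: cvgD; first exact: cvg_cst.
    by apply: cvgM; [exact: cvg_id|exact: cvg_cst].
  by apply: (@continuous_pair _ _ (fun t => (1 + t * (k - 1)) * v.1)
    (fun t => (1 + t * (k - 1)) * v.2)); apply: cvgM => //; exact: cvg_cst.
- by rewrite mul0r addr0 -scale_pairE scale1r.
- by rewrite mul1r addrC subrK.
- by move=> t t01; split=> //; rewrite -scale_pairE; apply: branchZ => //; apply: lt0r_neq0; nra.
Qed.

Lemma nonvanishing_same_sign (q : R -> R) : continuous q ->
  (forall t, 0 <= t <= 1 -> q t != 0) -> 0 < q 0 * q 1.
Proof.
move=> cq q0; rewrite ltNge; apply/negP => q01.
have [t] : exists2 t : R, t \in `[0, 1] & q t = 0.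
  apply: (IVT ler01); first exact: continuous_subspaceT.
  rewrite ge_min le_max; have [h|h] := lerP (q 0) 0; have [h'|h'] := lerP (q 1) 0 => //=; nra.
by rewrite in_itv/= => /q0/eqP.
Qed.

(* The quotient of the loops [Phi s] and [Phi s'] has a single-valued square root. *)
Let same_class (Phi : R -> R -> C) s s' := exists rho : R -> C,
  [/\ continuous rho, rho 0 = rho 1 &
     forall t, 0 <= t <= 1 -> branch (cmul (Phi s t) (cconj (Phi s' t))) (rho t)].

Lemma cmul_conj_pos z w : 0 < rdot z w -> half_dir (cmul z (cconj w)) != 0.
Proof.
rewrite /rdot => h; apply/eqP => /half_dir_eq0 /= [_]; lra.
Qed.

(** By compactness of [0, 1], for [s] near [s0] the vectors [Phi s t] and [Phi s0 t] make an acute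
    angle for all [t] at once; their quotient then stays off the negative half-line and [half_dir]
    is a root of it. *)
Let same_class_near (Phi : R -> R -> C) s0 :
  continuous (fun x : R * R => Phi x.1 x.2) ->
  (forall s t, Phi s t != 0) -> (forall s, Phi s 0 = Phi s 1) ->
  \forall s \near s0, same_class Phi s s0.
Proof.
move=> cPhi Phi0 loop.
have K := (compact_near_coveringP _).1 (@segment_compact R 0 1).
have : \forall s \near s0, `[0, 1]%classic `<=` (fun t => 0 < rdot (Phi s t) (Phi s0 t)).
  apply: (K _ (nbhs s0) (fun s t => 0 < rdot (Phi s t) (Phi s0 t))) => t _.
  have c : {for (t, s0), continuous (fun x : R * R => rdot (Phi x.2 x.1) (Phi s0 x.1))}.
    apply: continuous_rdot.
      apply: (@continuous_comp _ _ _ (fun x : R * R => (x.2, x.1)) (fun x : R * R => Phi x.1 x.2)).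
        by apply: continuous_pair; [exact: cvg_snd|exact: cvg_fst].
      exact: cPhi.
    apply: (@continuous_comp _ _ _ (fun x : R * R => (s0, x.1)) (fun x : R * R => Phi x.1 x.2)).
      by apply: continuous_pair; [exact: cvg_cst|exact: cvg_fst].
    exact: cPhi.
  have h : 0 < rdot (Phi s0 t) (Phi s0 t) by rewrite /rdot -!expr2 sqr_sum_gt0.
  exact: (cvgr_gt _ c _ h).
apply: filterS => s Hs.
exists (fun t => half_dir (cmul (Phi s t) (cconj (Phi s0 t)))); split.
- apply: continuous_forP => t; apply: continuous_half_dir; apply: continuous_cmul.
    apply: (@continuous_comp _ _ _ (fun t : R => (s, t)) (fun x : R * R => Phi x.1 x.2)); last exact: cPhi.
    by apply: continuous_pair; [exact: cvg_cst|exact: cvg_id].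
  apply: continuous_cconj.
  apply: (@continuous_comp _ _ _ (fun t : R => (s0, t)) (fun x : R * R => Phi x.1 x.2)); last exact: cPhi.
  by apply: continuous_pair; [exact: cvg_cst|exact: cvg_id].
- by rewrite !loop.
- move=> t t01; apply: half_dir_branch; apply: cmul_conj_pos; apply: Hs.
  by rewrite /= in_itv.
Qed.

Let same_class_sym Phi s s' : same_class Phi s s' -> same_class Phi s' s.
Proof.
move=> [rho [c l H]]; exists (fun t => cconj (rho t)); split.
- by apply: continuous_forP => t; exact/continuous_cconj/c.
- by rewrite l.
- move=> t t01; have := branch_conj (H t t01).
  by congr branch; apply: pair_ext => /=; ring.
Qed.

Let same_class_trans (Phi : R -> R -> C) s1 s2 s3 : (forall s t, Phi s t != 0) ->
  same_class Phi s1 s2 -> same_class Phi s2 s3 -> same_class Phi s1 s3.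
Proof.
move=> Phi0 [r [c l H]] [r' [c' l' H']]; exists (fun t => cmul (r t) (r' t)); split.
- by apply: continuous_forP => t; apply: continuous_cmul; [exact: c|exact: c'].
- by rewrite l l'.
- move=> t t01; have := branchM (H t t01) (H' t t01).
  have p := sqr_sum_gt0 (Phi0 s2 t).
  move=> b; apply: (branch_scaled p); move: b; congr branch.
  by rewrite scale_pairE; apply: pair_ext => /=; ring.
Qed.

(** [same_class] is an equivalence relation with open classes, so the connected parameter line is a
    single class. *)
Lemma homotopy_square_root (Phi : R -> R -> C) s1 s2 :
  continuous (fun x : R * R => Phi x.1 x.2) ->
  (forall s t, Phi s t != 0) -> (forall s, Phi s 0 = Phi s 1) ->
  exists rho : R -> C, [/\ continuous rho, rho 0 = rho 1 &
    forall t, 0 <= t <= 1 -> branch (cmul (Phi s1 t) (cconj (Phi s2 t))) (rho t)].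
Proof.
move=> cPhi Phi0 loop.
have near s0 := same_class_near s0 cPhi Phi0 loop.
have refl s : same_class Phi s s by exact: nbhs_singleton (near s).
suff : [set: R] `<=` [set s | same_class Phi s s2] by apply.
apply: (@connected_two_open _ _ _ [set s | ~ same_class Phi s s2] s2) => //=.
- by apply/connected_intervalP => ? ? ? ?.
- rewrite openE => s hs; apply: filterS (near s) => s' h; exact: same_class_trans h hs.
- rewrite openE => s hs; apply: filterS (near s) => s' h h'; apply: hs.
  exact: same_class_trans (same_class_sym h) h'.
- by move=> s _ /=; have [h|h] := pselect (same_class Phi s s2); [left|right].
- by rewrite -subset0 => s [[_ h] h'].
Qed.

Lemma simply_connected_no_monodromy Om F (g l : R -> C) :
  simply_connected Om -> (forall w, Om w -> {for w, continuous F}) ->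
  (forall w, Om w -> F w != 0) ->
  continuous g -> continuous l -> g 0 = g 1 ->
  (forall t, 0 <= t <= 1 -> Om (g t) /\ branch (F (g t)) (l t)) ->
  exists2 k, 0 < k & l 1 = k *: l 0.
Proof.
move=> [_ sc] cF F0 cg cl g01 H.
have z01 : 0 <= (0 : R) <= 1 by apply/andP; split; [exact: lexx|exact: ler01].
have o01 : 0 <= (1 : R) <= 1 by apply/andP; split; [exact: ler01|exact: lexx].
have [|h [ch hOm h0 h1 hs]] := sc (g 0) g.
  split=> //; first exact: continuous_subspaceT.
  by move=> _ [t /= + <-]; rewrite in_itv => /H[].
pose c2 (x : R * R) := (clamp x.1, clamp x.2).
have c2in y : (`[0, 1] `*` `[0, 1])%classic (c2 y).
  by split; rewrite /= in_itv /=; exact: clamp_itv.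
have hh : continuous (h \o c2).
  move=> x.
  have cc2 : {for x, continuous c2}.
    apply: continuous_pair.
      by apply: (@continuous_comp _ _ _ fst (@clamp R)); [exact: cvg_fst|exact: continuous_clamp].
    by apply: (@continuous_comp _ _ _ snd (@clamp R)); [exact: cvg_snd|exact: continuous_clamp].
  move: ch; rewrite subspace_continuousP => /(_ (c2 x)) ch.
  apply: (@cvg_comp _ _ _ c2 h _ (within (`[0, 1] `*` `[0, 1]) (nbhs (c2 x))));
    last by apply: ch; exact: c2in.
  move=> A /cc2 hA; apply: (@filterS _ (nbhs x) _ _ _ _ hA) => y hy.
  by apply: hy; exact: c2in.
have hOm' x : Om (h (c2 x)).
  by apply: hOm; exists (c2 x) => //; exact: c2in.
pose Phi s t := F (h (c2 (s, t))).
have cl0 : clamp 0 = 0 :> R by rewrite clamp_id.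
have cl1 : clamp 1 = 1 :> R by rewrite clamp_id.
have [rho [crho rho01 Hrho]] : exists rho : R -> C, [/\ continuous rho, rho 0 = rho 1 &
    forall t, 0 <= t <= 1 -> branch (cmul (Phi 0 t) (cconj (Phi 1 t))) (rho t)].
  apply: homotopy_square_root.
  - have -> : (fun x : R * R => Phi x.1 x.2) = F \o (h \o c2) by apply/funext => -[].
    by move=> x; apply: (continuous_comp (hh x)); apply: cF; exact: hOm'.
  - by move=> s t; apply: F0; exact: hOm'.
  - move=> s; rewrite /Phi /c2 /= cl0 cl1.
    by have [|-> ->] := hs (clamp s); first by rewrite in_itv /= clamp_itv.
have Om0 := (H 0 z01).1; have F00 := F0 _ Om0.
(* The contracted loop is constant, so [rho] is a single-valued root of F (g t) conj(F (g 0)).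
   Multiplying by [l 0], a root of F (g 0), leaves F (g t) up to the factor |F (g 0)|^2. *)
have b t : 0 <= t <= 1 -> branch (F (g t)) (cmul (l 0) (rho t)).
  move=> t01; have := branchM (H 0 z01).2 (Hrho t t01).
  rewrite /Phi /c2 /= cl0 cl1 (clamp_id t01) h0 ?in_itv// h1 ?in_itv// => bb.
  apply: (branch_scaled (sqr_sum_gt0 F00)); move: bb; congr branch.
  by rewrite scale_pairE; apply: pair_ext => /=; ring.
(* The two branches are real multiples of each other, so [q] never vanishes and its sign is that of
   the multiple; it is the same at 0 and at 1, while the second branch closes up. *)
pose q t := rdot (l t) (cmul (l 0) (rho t)).
have rdotN0 (u v : C) c : v != 0 -> c != 0 -> u = c *: v -> rdot u v = c * (v.1 ^+ 2 + v.2 ^+ 2).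
  by move=> v0 c0 ->; rewrite scale_pairE /rdot /=; ring.
have : 0 < q 0 * q 1.
  apply: nonvanishing_same_sign.
    apply: continuous_forP => t; apply: continuous_rdot; first exact: cl.
    by apply: continuous_cmul; [exact: cvg_cst|exact: crho].
  move=> t t01; have [c c0 e] := branch_proportional (H t t01).2 (b t t01).
  have v0 := (b t t01).1.
  by rewrite /q (rdotN0 _ _ c)// mulf_neq0// gt_eqF// sqr_sum_gt0.
have [c0 c00 e0] := branch_proportional (H 0 z01).2 (b 0 z01).
have [c1 c10 e1] := branch_proportional (H 1 o01).2 (b 1 o01).
rewrite /q (rdotN0 _ _ c0)//; last exact: (b 0 z01).1.
rewrite (rdotN0 _ _ c1)//; last exact: (b 1 o01).1.
rewrite -rho01 mulrACA pmulr_lgt0; last first.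
  by have p := sqr_sum_gt0 (b 0 z01).1; rewrite mulr_gt0.
move=> cc; exists (c1 / c0).
  by rewrite -(@pmulr_lgt0 _ (c0 ^+ 2)) ?exprn_even_gt0// expr2 mulrA mulfVK// mulrC.
by rewrite e1 -rho01 [in RHS]e0 scalerA mulfVK.
Qed.

End Monodromy.

(** * Crosscuts *)

Section Crosscut.
Variable R : realType.
Notation C := (R * R)%type.
Implicit Types (z w u v : C) (k t s : R) (Om : set C) (F : C -> C).

Lemma ball_segment (x a b : C) (r t : R) : 0 <= t <= 1 ->
  ball x r a -> ball x r b -> ball x r (a + t *: (b - a)).
Proof.
rewrite -ball_normE /ball_ /= => /andP[t0 t1] ha hb.
have -> : x - (a + t *: (b - a)) = (1 - t) *: (x - a) + t *: (x - b).
  by rewrite !scale_pairE; apply: pair_ext => /=; ring.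
apply: (le_lt_trans (ler_normD _ _)); rewrite !normrZ !ger0_norm//; last lra.
have [->|tn0] := eqVneq t 0; first by rewrite mul0r addr0 subr0 mul1r.
have tp : 0 < t by rewrite lt0r tn0.
nra.
Qed.

(** Along short segments inside [O] the continuation is given by [v], so the points reached are open
    and closed relative to [E]. The path runs in [O]; [E] may fail to be path connected. *)
Lemma continues_connected Om F (O E : set C) (v : C -> C) w w' :
  open O -> O `<=` Om -> (forall x, O x -> {for x, continuous v}) ->
  (forall x, O x -> branch (F x) (v x)) ->
  connected E -> E `<=` O -> E w -> E w' -> continues Om F w (v w) w' (v w').
Proof.
move=> oO OOm cv bv cE EO Ew Ew'.
have loc x : O x -> \forall y \near x, O y /\ continues Om F x (v x) y (v y).
  move=> Ox; have [r r0 rO] : exists2 r : R, 0 < r & ball x r `<=` O.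
    by have /nbhs_ballP[r /= r0 h] := open_nbhs_nbhs (conj oO Ox); exists r.
  apply/nbhs_ballP; exists r => //= y yr; split; first exact: rO.
  pose g t := x + clamp t *: (y - x).
  have gO t : O (g t).
    by apply: rO; apply: ball_segment => //; [exact: clamp_itv|exact: ballxx].
  have cg : continuous g.
    have -> : g = (fun t => (x.1 + clamp t * (y.1 - x.1), x.2 + clamp t * (y.2 - x.2))) by [].
    apply: continuous_forP => t; apply: continuous_pair; (apply: cvgD; first exact: cvg_cst);
    by apply: cvgM; [exact: continuous_clamp|exact: cvg_cst].
  exists g, (v \o g); split => //.
  - by move=> t; apply: (continuous_comp (cg t)); exact: cv.
  - by rewrite /= /g clamp_le0// scale0r addr0.
  - by rewrite /= /g clamp_ge1// scale1r addrC subrK.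
  - by move=> t t01; split; [exact: OOm|exact: bv].
suff : E `<=` [set x | O x /\ continues Om F w (v w) x (v x)] by move=> /(_ _ Ew')[].
have loc0 x : O x -> continues Om F x (v x) x (v x).
  by move=> /loc/nbhs_singleton[].
apply: (@connected_two_open _ _ _ [set x | O x /\ ~ continues Om F w (v w) x (v x)] w) => //.
- rewrite openE => x [Ox hx]; apply: filterS (loc x Ox) => y [Oy h]; split=> //.
  exact: continues_trans h.
- rewrite openE => x [Ox hx]; apply: filterS (loc x Ox) => y [Oy h]; split=> // h'.
  by apply: hx; apply: continues_trans h' _; exact: continues_sym.
- move=> x /EO Ox /=; have [h|h] := pselect (continues Om F w (v w) x (v x)); [by left|by right].
- by rewrite -subset0 => s [[_ [_ h]] [_ h']].
- by split; [exact: EO|apply: loc0; exact: EO].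
Qed.

(** A positive multiple of (w - a) / (w - b) for [w] other than [b], and defined everywhere. *)
Definition ratio (a b w : C) : C := cmul (w - a) (cconj (w - b)).

Lemma half_dir_ratio_neq0 a b w : half_dir (ratio a b w) != 0 -> w != a /\ w != b.
Proof.
move=> h; split; apply: contraNneq h => ->; rewrite /ratio subrr; apply/eqP/pair_ext;
  by rewrite /half_dir /nrm2 /= !(mul0r, mulr0, subrr, addr0, add0r, oppr0) ?expr0n ?addr0 ?sqrtr0.
Qed.

(** A real quotient puts [w] on the line through [a] and [b], a nonpositive one puts it between
    them: the branch cut of this root is the segment. *)
Lemma half_dir_ratio_eq0 a b w : half_dir (ratio a b w) = 0 -> exists2 t, 0 <= t <= 1 & w = a + t *: (b - a).
Proof.
move=> /half_dir_eq0[]; rewrite /ratio /=.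
move=> e2 e1; have [->|wa] := eqVneq w a; first by exists 0; rewrite ?lexx ?ler01// scale0r addr0.
rewrite -subr_eq0 in wa; have p := sqr_sum_gt0 wa; rewrite /= in p.
set dx := w.1 - a.1 in p e1 e2 *; set dy := w.2 - a.2 in p e1 e2 *.
have hb : 0 < (b.1 - a.1) ^+ 2 + (b.2 - a.2) ^+ 2.
  apply: (@sqr_sum_gt0 R (b - a)); apply: contraTneq p => ba.
  have b1 : b = a by apply/eqP; rewrite -subr_eq0 ba.
  by move: e1; rewrite b1 -/dx -/dy; rewrite -leNgt; nra.
set ex := b.1 - a.1 in hb; set ey := b.2 - a.2 in hb.
have [x1 x2] : w.1 - b.1 = dx - ex /\ w.2 - b.2 = dy - ey by rewrite /dx /dy /ex /ey; split; ring.
rewrite x1 x2 in e1 e2.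
have cr : dy * ex - dx * ey = 0 by nra.
have dt : dx ^+ 2 + dy ^+ 2 <= dx * ex + dy * ey by nra.
set D := ex ^+ 2 + ey ^+ 2 in hb.
have cs : (dx * ex + dy * ey) ^+ 2 = (dx ^+ 2 + dy ^+ 2) * D.
  have -> : (dx ^+ 2 + dy ^+ 2) * D = (dx * ex + dy * ey) ^+ 2 + (dy * ex - dx * ey) ^+ 2 by rewrite /D; ring.
  by rewrite cr expr0n addr0.
exists ((dx * ex + dy * ey) / D).
  apply/andP; split; first by rewrite divr_ge0 ?ltW//; nra.
  by rewrite ler_pdivrMr// mul1r; nra.
rewrite scale_pairE; apply: pair_ext => /=.
  rewrite -[LHS](addrNK a.1) addrC; congr (_ + _); rewrite -/dx -/ex.
  apply: (mulIf (lt0r_neq0 hb)); rewrite [RHS]mulrAC mulfVK ?gt_eqF//.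
  have -> : dx * D = (dx * ex + dy * ey) * ex - ey * (dy * ex - dx * ey) by rewrite /D; ring.
  by rewrite cr mulr0 subr0.
rewrite -[LHS](addrNK a.2) addrC; congr (_ + _); rewrite -/dy -/ey.
apply: (mulIf (lt0r_neq0 hb)); rewrite [RHS]mulrAC mulfVK ?gt_eqF//.
have -> : dy * D = (dx * ex + dy * ey) * ey + ex * (dy * ex - dx * ey) by rewrite /D; ring.
by rewrite cr mulr0 addr0.
Qed.

Lemma continuous_ratio a b : continuous (ratio a b).
Proof.
apply: continuous_forP => w; apply: continuous_cmul.
  by apply: cvgB; [exact: cvg_id|exact: cvg_cst].
by apply: continuous_cconj; apply: cvgB; [exact: cvg_id|exact: cvg_cst].
Qed.

(** The root of [z] as i times a root of -z; its cut is the nonnegative half-line instead of the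
    nonpositive one. *)
Definition turned_half_dir z : C := cmul (0, 1) (half_dir (- z)).

Lemma turned_half_dir_branch z : turned_half_dir z != 0 -> branch z (turned_half_dir z).
Proof.
move=> r0; split=> //.
have [|_ [k k0 [e1 e2]]] := @half_dir_branch _ (- z).
  by apply: contra r0 => /eqP h; rewrite /turned_half_dir h; apply/eqP/pair_ext => /=; ring.
exists k => //.
have f1 : (half_dir (- z)).1 * (half_dir (- z)).1 - (half_dir (- z)).2 * (half_dir (- z)).2 = k * (- z.1) := e1.
have f2 : (half_dir (- z)).1 * (half_dir (- z)).2 + (half_dir (- z)).2 * (half_dir (- z)).1 = k * (- z.2) := e2.
rewrite scale_pairE /turned_half_dir; set h := half_dir (- z) in f1 f2 *; clearbody h.
by apply: pair_ext => /=; nra.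
Qed.

(** The roots with the two opposite cuts agree in the upper half-plane and are opposite in the lower
    one, up to positive factors; this change of sign is the monodromy produced by a crosscut. *)
Lemma half_dir_opp z : z.2 != 0 ->
  exists2 k, half_dir z = k *: turned_half_dir z & (0 < z.2 -> 0 < k) /\ (z.2 < 0 -> k < 0).
Proof.
move=> z2; have n2 := sqr_nrm2 z; have n0 := nrm2_ge0 z.
have y2 : 0 < z.2 ^+ 2 by rewrite exprn_even_gt0.
have xn : 0 < z.1 + nrm2 z by nra.
exists ((z.1 + nrm2 z) / z.2); last first.
  by split=> h; [exact: divr_gt0|rewrite pmulr_rlt0// invr_lt0].
have nN : nrm2 (- z) = nrm2 z by rewrite /nrm2 /= !sqrrN.
rewrite scale_pairE /turned_half_dir /half_dir nN; apply: pair_ext => /=.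
  by rewrite mul0r mul1r opprK add0r mulfVK.
apply: (mulIf z2); rewrite [RHS]mulrAC mulfVK//; nra.
Qed.

(* The broken line [a]-[c]-[p]-[z], where [g3] is a square root of
   (w - p) / (w - z) branched along its last part, is a crosscut of a simply
   connected domain avoiding [a] and [z]: comparing this square root of
   (w - a) / (w - z) with the one turned through the midpoint of [c, p] shows
   that the two sides of [c, p] are not connected off the crosscut. *)
Lemma crosscut_separates Om (E : set C) (g3 : C -> C) a c p z :
  open Om -> simply_connected Om -> ~ Om a -> ~ Om z ->
  continuous g3 -> (forall w, g3 w != 0 -> branch (ratio p z w) (g3 w)) ->
  let m := c + 2^-1 *: (p - c) in
  c != p -> Om m -> half_dir (ratio a c m) != 0 -> g3 m != 0 ->
  connected E -> E `<=` Om ->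
  (forall w, E w -> [/\ half_dir (ratio a c w) != 0, half_dir (ratio c p w) != 0 & g3 w != 0]) ->
  (forall N, nbhs m N -> exists w1 w2, [/\ E w1 /\ N w1, E w2 /\ N w2,
     0 < (ratio c p w1).2 & (ratio c p w2).2 < 0]) ->
  False.
Proof.
move=> oOm scOm aOm zOm cg3 bg3 m cp Omm acm g3m cE EOm E0 Nm.
pose F w := ratio a z w.
pose G w := cmul (cmul (half_dir (ratio a c w)) (half_dir (ratio c p w))) (g3 w).
pose G' w := cmul (cmul (half_dir (ratio a c w)) (turned_half_dir (ratio c p w))) (g3 w).
have cG : continuous G.
  apply: continuous_forP => w; apply: continuous_cmul; last exact: cg3.
  by apply: continuous_cmul; apply: continuous_half_dir; exact: continuous_ratio.
have cG' : continuous G'.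
  apply: continuous_forP => w; apply: continuous_cmul; last exact: cg3.
  apply: continuous_cmul; first by apply: continuous_half_dir; exact: continuous_ratio.
  apply: continuous_cmul; first exact: cvg_cst.
  by apply: continuous_half_dir; apply: cvgN; exact: continuous_ratio.
have cF : continuous F by exact: continuous_ratio.
have F0 w : Om w -> F w != 0.
  move=> Ow; have wa : w - a != 0 by rewrite subr_eq0; apply/eqP => wa; apply: aOm; rewrite -wa.
  have wz : w - z != 0 by rewrite subr_eq0; apply/eqP => wz; apply: zOm; rewrite -wz.
  by rewrite /F /ratio cmul_neq0 wa cconj_neq0.
have combine w u1 u2 : w != c -> w != p -> branch (ratio a c w) u1 -> branch (ratio c p w) u2 ->
  g3 w != 0 -> branch (F w) (cmul (cmul u1 u2) (g3 w)).
  move=> wc wp b1 b2 b3; have := branchM (branchM b1 b2) (bg3 w b3).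
  rewrite -subr_eq0 in wc; rewrite -subr_eq0 in wp.
  have pos := mulr_gt0 (sqr_sum_gt0 wc) (sqr_sum_gt0 wp).
  move=> b; apply: (branch_scaled pos); move: b; congr branch.
  by rewrite scale_pairE /F /ratio; apply: pair_ext => /=; ring.
have hd0 x y : cmul x y != 0 -> x != 0 /\ y != 0 :> C by rewrite cmul_neq0 => /andP.
have cmul0 x y : x != 0 -> y != 0 :> C -> cmul x y != 0 by rewrite cmul_neq0 => -> ->.
have open0 (H : C -> C) : continuous H -> open [set w | Om w /\ H w != 0].
  move=> cH; rewrite openE => w [Ow Hw]; near=> w'.
  by split; near: w'; [exact: open_nbhs_nbhs|exact: (cvgr_neq0 _ (cH w) Hw)].
pose O := [set w | Om w /\ G w != 0].
pose O' := [set w | Om w /\ (cmul (G' w) (ratio c p w)) != 0].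
have bG w : O w -> branch (F w) (G w).
  move=> [Ow /hd0[/hd0[h1 h2] h3]]; have [wc wp] := half_dir_ratio_neq0 h2.
  by apply: combine => //; exact: half_dir_branch.
have bG' w : O' w -> branch (F w) (G' w).
  move=> [Ow /hd0[/hd0[/hd0[h1 h2] h3] h4]]; apply: combine => //.
  - by apply: contra h4 => /eqP ->; apply/eqP/pair_ext; rewrite /= !subrr; ring.
  - by apply: contra h4 => /eqP ->; apply/eqP/pair_ext; rewrite /= !subrr; ring.
  - exact: half_dir_branch.
  - exact: turned_half_dir_branch.
have O'm : O' m.
  split=> //.
  (* At the midpoint the quotient is -|p - c|^2 / 4: on the cut of [half_dir], off the cut of
     [turned_half_dir]. *)
  have dm : ratio c p m = (- (2^-1 * 2^-1 * ((p - c).1 ^+ 2 + (p - c).2 ^+ 2)), 0).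
    by rewrite /ratio /m scale_pairE; apply: pair_ext => /=; field.
  have pc : 0 < (p - c).1 ^+ 2 + (p - c).2 ^+ 2.
    by apply: sqr_sum_gt0; rewrite subr_eq0 eq_sym.
  have K0 : 0 < 2^-1 * 2^-1 * ((p - c).1 ^+ 2 + (p - c).2 ^+ 2).
    by rewrite !mulr_gt0.
  rewrite /G' dm; move: K0; set K := 2^-1 * _ * _ => K0.
  apply: (cmul0); last by apply/eqP => -[/eqP]; rewrite oppr_eq0 gt_eqF.
  apply: (cmul0) => //; apply: (cmul0) => //.
  rewrite /turned_half_dir; apply: (cmul0); first by apply/eqP => -[/eqP]; rewrite oner_eq0.
  apply: half_dir_neq0; first by apply/eqP => -[/eqP]; rewrite opprK gt_eqF.
  by rewrite /= opprK negb_and -ltNge K0 orbT.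
have oO : open O by exact: open0.
have oO' : open O'.
  apply: open0; apply: continuous_forP => w; apply: continuous_cmul; first exact: cG'.
  exact: continuous_ratio.
have /nbhs_ballP[r /= r0 rO'] := open_nbhs_nbhs (conj oO' O'm).
have [w1 [w2 [[Ew1 Nw1] [Ew2 Nw2] s1 s2]]] := Nm _ (nbhsx_ballx m r r0).
have EO : E `<=` O.
  move=> w Ew; split; first exact: EOm.
  by have [? ? ?] := E0 w Ew; apply: (cmul0) => //; apply: (cmul0).
have c1 : continues Om F w1 (G w1) w2 (G w2).
  apply: (continues_connected oO _ (fun x _ => cG x) bG cE EO) => //.
  by move=> ? [].
have cb : connected (ball m r).
  have -> : ball m r = \bigcup_(y in ball m r) ((fun t => m + t *: (y - m)) @` `[0, 1]).
    apply/seteqP; split=> [y hy|y [x hx [t]]].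
      by exists y => //; exists 1; rewrite /= ?in_itv/= ?lexx ?ler01// scale1r addrC subrK.
    rewrite /= in_itv /= => t01 <-; apply: ball_segment => //; exact: ballxx.
  apply: bigcup_connected.
    by exists m => y hy; exists 0; rewrite /= ?in_itv/= ?lexx ?ler01// scale0r addr0.
  move=> y _; apply: connected_continuous_connected; first exact: segment_connected.
  apply: continuous_subspaceT.
  have -> : (fun t : R => m + t *: (y - m)) = (fun t => (m.1 + t * (y.1 - m.1), m.2 + t * (y.2 - m.2))) by [].
  apply: continuous_forP => t; apply: continuous_pair; (apply: cvgD; first exact: cvg_cst);
  by apply: cvgM; [exact: cvg_id|exact: cvg_cst].
have c2 : continues Om F w1 (G' w1) w2 (G' w2).
  apply: (continues_connected oO' _ (fun x _ => cG' x) bG' cb rO') => //.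
  by move=> ? [].
have GG' w k : half_dir (ratio c p w) = k *: turned_half_dir (ratio c p w) -> G w = k *: G' w.
  by move=> e; rewrite /G /G' e !scale_pairE; apply: pair_ext => /=; ring.
have [k1 /GG' e1 [k10 _]] := half_dir_opp (lt0r_neq0 s1).
have [k2 /GG' e2 [_ k20]] := half_dir_opp (ltr0_neq0 s2).
have {}k10 := k10 s1; have {}k20 := k20 s2.
have Ow1 := (rO' _ Nw1).1; have Ow2 := (rO' _ Nw2).1.
have c3 : continues Om F w1 (G w1) w2 (G' w2).
  apply: continues_trans c2; rewrite e1; apply: continues_sym.
  by apply: continues_scale => //; exact: (bG' _ (rO' _ Nw1)).
(* This loop goes from [w2] to [w1] through the small ball, where [G'] is continuous, and comes back
   through [O], where [G] is. It carries [G' w2] to [G w2], a negative multiple. *)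
have [g [l [cg cl [g0 l0] [g1 l1] H]]] := continues_trans (continues_sym c3) c1.
have g01 : g 0 = g 1 by rewrite g0 g1.
have [k k0] := simply_connected_no_monodromy scOm (fun w _ => cF w) F0 cg cl g01 H.
rewrite l0 l1 e2 => /eqP; rewrite -subr_eq0 -scalerBl scaler_eq0 subr_eq0.
by rewrite (negbTE (bG' _ (rO' _ Nw2)).1) orbF => /eqP k2k; move: k20; rewrite k2k ltNge ltW.
Unshelve. all: end_near. Qed.

End Crosscut.

(** * A parametrization of the unit sphere of the max norm *)

Section CircleParametrization.
Variable R : realType.
Notation C := (R * R)%type.
Implicit Types (u a : C) (k s t : R).

(* The direction of a (s + i k (1 - s^2))^2: for k = 1 or -1, as [s] runs over
   [-1, 1] it turns once around the unit sphere of the max norm, from [a] to [a]. *)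
Definition turn k a s : C := cmul a (s ^+ 2 - (1 - s ^+ 2) ^+ 2, k * (2 * s * (1 - s ^+ 2))).
Definition dir k a s : C := `|turn k a s|^-1 *: turn k a s.
(** The inner product of the vectors s + i (1 - s^2) and t + i (1 - t^2) that [turn] squares:
    positive when these half-angles differ by less than a right angle. *)
Definition half_dot s t : R := s * t + (1 - s ^+ 2) * (1 - t ^+ 2).

Lemma half_dot_gt0 s : 0 < half_dot s s.
Proof. rewrite /half_dot; nra. Qed.

Lemma continuous_half_dot : continuous (fun x : R * R => half_dot x.1 x.2).
Proof.
apply: continuous_forP => x; apply: cvgD; first by apply: cvgM; [exact: cvg_fst|exact: cvg_snd].
by apply: cvgM; apply: cvgB; (try exact: cvg_cst); apply: cvgM; (exact: cvg_fst || exact: cvg_snd).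
Qed.

Lemma one_plus_mul_gt0 s t : -1 < s < 1 -> -1 <= t <= 1 -> 0 < 1 + s * t.
Proof.
move=> /andP[s0 s1] /andP[t0 t1]; have [t2|t2|->] := ltgtP t 0.
- have : 0 < - t * (1 - s) by rewrite mulr_gt0//; lra.
  nra.
- have : 0 < t * (1 + s) by rewrite mulr_gt0//; lra.
  nra.
- by rewrite mulr0 addr0.
Qed.

Variables (k : R) (a : C).
Hypotheses (k2 : k ^+ 2 = 1) (a1 : `|a| = 1).

Let a_neq0 : a != 0.
Proof. by apply/eqP => a0; move: a1; rewrite a0 normr0 => /eqP; rewrite eq_sym oner_eq0. Qed.

Let k_neq0 : k != 0.
Proof. by apply/eqP => k0; move: k2; rewrite k0 expr0n => /eqP; rewrite eq_sym oner_eq0. Qed.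

(** The double-angle formula: (s - t) (1 + s t) is, up to [k], the cross product of the half-angle
    vectors. *)
Lemma cross_turn s t : cross (turn k a s) (turn k a t) =
  k * ((a.1 ^+ 2 + a.2 ^+ 2) * (2 * half_dot s t) * (1 + s * t)) * (s - t).
Proof. by rewrite /cross /turn /half_dot /=; ring. Qed.

Lemma rdot_turn s t : rdot (turn k a s) (turn k a t) =
  (a.1 ^+ 2 + a.2 ^+ 2) * (half_dot s t ^+ 2 - ((s - t) * (1 + s * t)) ^+ 2).
Proof.
rewrite /rdot /turn /half_dot /=.
have e x y : (k * x) * (k * y) = x * y by rewrite mulrACA -expr2 k2 mul1r.
set x := s ^+ 2 - _; set y := 2 * s * _; set x' := t ^+ 2 - _; set y' := 2 * t * _.
have -> : (a.1 * x - a.2 * (k * y)) * (a.1 * x' - a.2 * (k * y')) +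
  (a.1 * (k * y) + a.2 * x) * (a.1 * (k * y') + a.2 * x') =
  (a.1 ^+ 2 + a.2 ^+ 2) * (x * x' + (k * y) * (k * y')) by ring.
by rewrite e /x /x' /y /y'; ring.
Qed.

Lemma turn_neq0 s : turn k a s != 0.
Proof.
apply/eqP => e; have : rdot (turn k a s) (turn k a s) = 0 by rewrite e /rdot /= !mul0r addr0.
rewrite rdot_turn subrr mul0r expr0n subr0 => /eqP; apply/negP.
by rewrite gt_eqF// mulr_gt0 ?exprn_gt0 ?half_dot_gt0 ?sqr_sum_gt0.
Qed.

Lemma norm_turn_gt0 s : 0 < `|turn k a s|. Proof. by rewrite normr_gt0 turn_neq0. Qed.

Lemma norm_dir s : `|dir k a s| = 1.
Proof. by rewrite normrZ normfV normr_id mulVf// gt_eqF// norm_turn_gt0. Qed.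

Lemma turnE s : turn k a s = `|turn k a s| *: dir k a s.
Proof. by rewrite scalerA divff ?scale1r// gt_eqF// norm_turn_gt0. Qed.

Lemma dir1 : dir k a 1 = a.
Proof.
have e : turn k a 1 = a by rewrite /turn; apply: pair_ext => /=; ring.
by rewrite /dir e a1 invr1 scale1r.
Qed.

Lemma continuous_dir : continuous (dir k a).
Proof.
have c : continuous (turn k a).
  apply: continuous_forP => s; apply: continuous_cmul; first exact: cvg_cst.
  have cs : {for s, continuous (fun s : R => s ^+ 2)} by apply: cvgM; exact: cvg_id.
  have cw : {for s, continuous (fun s : R => 1 - s ^+ 2)} by apply: cvgB => //; exact: cvg_cst.
  apply: continuous_pair; first by apply: cvgB => //; apply: cvgM.
  by apply: cvgM; [exact: cvg_cst|apply: cvgM => //; apply: cvgM; [exact: cvg_cst|exact: cvg_id]].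
have cn s : {for s, continuous (fun s => `|turn k a s|^-1)}.
  apply: cvgV; first by rewrite gt_eqF// norm_turn_gt0.
  by apply: cvg_norm; exact: c.
apply: continuous_forP => s.
apply: (@continuous_pair _ _ (fun s => `|turn k a s|^-1 * (turn k a s).1)
  (fun s => `|turn k a s|^-1 * (turn k a s).2)).
  by apply: cvgM; [exact: cn|exact: (continuous_fst (c s))].
by apply: cvgM; [exact: cn|exact: (continuous_snd (c s))].
Qed.

Lemma cross_dir s t : cross (dir k a s) (dir k a t) =
  (`|turn k a s| * `|turn k a t|)^-1 * cross (turn k a s) (turn k a t).
Proof. by rewrite invfM /dir !scale_pairE /cross /=; ring. Qed.

(** Equal directions have zero cross product and positive inner product. By [cross_turn] either s =
    t or [half_dot s t] vanishes, and the latter would make the inner product nonpositive. *)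
Lemma dir_inj s t : -1 < s < 1 -> -1 <= t <= 1 -> dir k a s = dir k a t -> s = t.
Proof.
move=> s1 t1 e; have c0 : cross (turn k a s) (turn k a t) = 0.
  by rewrite turnE [turn k a t]turnE e !scale_pairE /cross /=; ring.
have d0 : 0 < rdot (turn k a s) (turn k a t).
  rewrite turnE [turn k a t]turnE e; set d := dir k a t.
  have dn : 0 < d.1 ^+ 2 + d.2 ^+ 2.
    by apply: sqr_sum_gt0; rewrite -normr_gt0 norm_dir ltr01.
  have -> : rdot (`|turn k a s| *: d) (`|turn k a t| *: d) =
    `|turn k a s| * `|turn k a t| * (d.1 ^+ 2 + d.2 ^+ 2) by rewrite !scale_pairE /rdot /=; ring.
  by rewrite mulr_gt0// mulr_gt0 ?norm_turn_gt0.
have A := sqr_sum_gt0 a_neq0.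
have st := one_plus_mul_gt0 s1 t1.
have h0 : half_dot s t != 0.
  apply: contraTneq d0 => h; rewrite rdot_turn h -leNgt pmulr_rle0//.
  by rewrite expr0n sub0r oppr_le0 sqr_ge0.
move/eqP: c0; rewrite cross_turn mulf_eq0 subr_eq0 => /orP[|/eqP//]; apply: contraTeq => _.
by rewrite !mulf_neq0// ?gt_eqF.
Qed.

Lemma dir_surj u : `|u| = 1 -> u != a -> exists2 s, -1 < s < 1 & dir k a s = u.
Proof.
move=> u1 ua; have A := sqr_sum_gt0 a_neq0; set N := a.1 ^+ 2 + a.2 ^+ 2 in A.
suff [s s1 [c c0 e]] : exists2 s, -1 < s < 1 & exists2 c, 0 < c & turn k a s = c *: u.
  exists s => //; rewrite /dir e normrZ u1 mulr1 (gtr0_norm c0) scalerA mulVf ?scale1r//.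
  by rewrite gt_eqF.
set X := rdot u a / N; set Y := k * (cross a u / N).
have XN : X * N = rdot u a by rewrite mulfVK// gt_eqF.
have kYN : k * Y * N = cross a u.
  by rewrite /Y mulrA -expr2 k2 mul1r mulfVK// gt_eqF.
have uE : u = cmul a (X, k * Y).
  move: kYN; set Z := k * Y => kYN; apply: pair_ext => /=; apply: (mulIf (lt0r_neq0 A)).
    have -> : (a.1 * X - a.2 * Z) * N = a.1 * (X * N) - a.2 * (Z * N) by ring.
    by rewrite XN kYN /rdot /cross /N; ring.
  have -> : (a.1 * Z + a.2 * X) * N = a.1 * (Z * N) + a.2 * (X * N) by ring.
  by rewrite XN kYN /rdot /cross /N; ring.
suff [s s1 [c c0 [e1 e2]]] : exists2 s, -1 < s < 1 & exists2 c, 0 < c &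
    s ^+ 2 - (1 - s ^+ 2) ^+ 2 = c * X /\ 2 * s * (1 - s ^+ 2) = c * Y.
  exists s => //; exists c => //.
  by rewrite /turn e1 e2 uE scale_pairE; apply: pair_ext => /=; ring.
have [Y0|Y0] := eqVneq Y 0.
  have uXa : u = X *: a by rewrite uE Y0 mulr0 scale_pairE; apply: pair_ext => /=; ring.
  have X0 : X < 0.
    rewrite ltNge; apply: contra ua => X0; apply/eqP.
    by move: u1; rewrite uXa normrZ a1 mulr1 ger0_norm// => ->; rewrite scale1r.
  exists 0; first by rewrite ltrN10 ltr01.
  exists (- X^-1); first by rewrite oppr_gt0 invr_lt0.
  by rewrite Y0 mulNr mulVf ?lt_eqF//; split; ring.
pose n := nrm2 (X, Y); have nE : n ^+ 2 = X ^+ 2 + Y ^+ 2 := sqr_nrm2 (X, Y).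
have n0 : 0 <= n := nrm2_ge0 _.
have Y2 : 0 < Y ^+ 2 by rewrite exprn_even_gt0.
have Xn : 0 < X + n by nra.
(* The half-angle vector (s, 1 - s^2) must be parallel to the half direction (X + n, Y) of (X, Y).
   This is the quadratic equation s / (1 - s^2) = t, whose root in (-1, 1) is 2 t / (1 + D). *)
pose t := (X + n) / Y; pose D := Num.sqrt (1 + 4 * t ^+ 2).
have DE : D ^+ 2 = 1 + 4 * t ^+ 2 by rewrite sqr_sqrtr//; nra.
have D0 : 0 <= D by exact: sqrtr_ge0.
pose s := 2 * t / (1 + D); pose w := 2 / (1 + D).
have D1 : 1 + D != 0 by rewrite gt_eqF// ltr_pwDl.
have sE : s = t * w by rewrite /s /w; field.
have w0 : 0 < w by rewrite divr_gt0// ltr_pwDl.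
have wE : 1 - s ^+ 2 = w.
  apply: (mulIf (expf_neq0 2 D1)).
  have -> : (1 - s ^+ 2) * (1 + D) ^+ 2 = (1 + D) ^+ 2 - (2 * t) ^+ 2 by rewrite /s; field.
  have -> : w * (1 + D) ^+ 2 = 2 * (1 + D) by rewrite /w; field.
  by nra.
exists s; first by nra.
have tY : t * Y = X + n by rewrite /t mulfVK.
exists (w ^+ 2 * (2 * (X + n) / Y ^+ 2)).
  by rewrite mulr_gt0 ?exprn_gt0// divr_gt0// mulr_gt0.
rewrite wE sE; split; apply: (mulIf (lt0r_neq0 Y2)).
  have -> : ((t * w) ^+ 2 - w ^+ 2) * Y ^+ 2 = w ^+ 2 * ((t * Y) ^+ 2 - Y ^+ 2) by ring.
  have -> : w ^+ 2 * (2 * (X + n) / Y ^+ 2) * X * Y ^+ 2 = w ^+ 2 * (2 * (X + n) * X) by field.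
  by rewrite tY; congr (_ * _); nra.
have -> : 2 * (t * w) * w * Y ^+ 2 = w ^+ 2 * (2 * (t * Y) * Y) by ring.
by rewrite tY; field.
Qed.

Lemma cross_dir_sign s t : 0 < half_dot s t -> 0 < 1 + s * t ->
  exists2 c, 0 < c & k * cross (dir k a s) (dir k a t) = c * (s - t).
Proof.
move=> h0 st; have A := sqr_sum_gt0 a_neq0.
exists ((`|turn k a s| * `|turn k a t|)^-1 *
   ((a.1 ^+ 2 + a.2 ^+ 2) * (2 * half_dot s t) * (1 + s * t))).
  by rewrite mulr_gt0// ?invr_gt0 !mulr_gt0// norm_turn_gt0.
rewrite cross_dir cross_turn; set K := _^-1; set L := _ * (1 + _).
by have -> : k * (K * (k * L * (s - t))) = k ^+ 2 * (K * L * (s - t)) by [ring]; rewrite k2 mul1r.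
Qed.

(** Cramer's rule: the coefficients are quotients of cross products whose signs are given by
    [cross_dir_sign]. *)
Lemma dir_between s t r : s < t < r -> 0 < half_dot s t -> 0 < half_dot t r ->
  0 < half_dot s r -> 0 < 1 + s * t -> 0 < 1 + t * r -> 0 < 1 + s * r ->
  exists l m, [/\ 0 < l, 0 < m & dir k a t = l *: dir k a s + m *: dir k a r].
Proof.
move=> /andP[st tr] h1 h2 h3 g1 g2 g3.
have [c1 c10 e1] := cross_dir_sign h1 g1.
have [c2 c20 e2] := cross_dir_sign h2 g2.
have [c3 c30 e3] := cross_dir_sign h3 g3.
set u := dir k a s in e1 e3 *; set v := dir k a t in e1 e2 *; set w := dir k a r in e2 e3 *.
have sr : s - r < 0 by lra.
have neg c x : 0 < c -> x < 0 -> c * x < 0 :> R by move=> c0 x0; rewrite pmulr_rlt0.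
have k3 : k * cross u w < 0 by rewrite e3 neg.
exists ((k * cross v w) / (k * cross u w)), ((k * cross u v) / (k * cross u w)); split.
- by rewrite ltr_ndivlMr// mul0r e2 neg//; lra.
- by rewrite ltr_ndivlMr// mul0r e1 neg//; lra.
- have f (p q P x y z : R) : P < 0 -> z * P = p * x + q * y -> z = p / P * x + q / P * y.
    move=> P0 e; apply: (mulIf (ltr0_neq0 P0)); rewrite e; field.
    exact: ltr0_neq0.
  clearbody u v w.
  by rewrite !scale_pairE; apply: pair_ext => /=; apply: f => //; rewrite /cross; ring.
Qed.

End CircleParametrization.

Lemma dir_opp (R : realType) (k s : R) a : dir k a (- s) = dir (- k) a s.
Proof.
rewrite /dir; suff -> : turn k a (- s) = turn (- k) a s by [].
by rewrite /turn; apply: pair_ext => /=; ring.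
Qed.

(** * Squares and compact connected sets *)

Section PlaneTopology.
Variable R : realType.
Notation C := (R * R)%type.
Implicit Types (c p q u w x y z : C) (r s t : R) (O Om E K M : set C).

Definition cball c r : set C := [set w | `|w - c| <= r].

Lemma norm_pair_le w r : (`|w| <= r) = (`|w.1| <= r) && (`|w.2| <= r).
Proof. by rewrite prod_normE ge_max. Qed.

Lemma ball_distE c r : ball c r = [set w | `|w - c| < r].
Proof. by rewrite -ball_normE; apply/seteqP; split=> w; rewrite /ball_ /= distrC. Qed.

Lemma closure_ball_cball c r : 0 < r -> closure (ball c r) = cball c r.
Proof.
move=> r0; rewrite -/(closed_ball c r) closed_ballE//.
by apply/seteqP; split=> w; rewrite /closed_ball_ /cball /= distrC.
Qed.

Lemma open_ball c r : open (ball c r).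
Proof.
rewrite ball_distE openE => w /= wr; have d0 : 0 < r - `|w - c| by rewrite subr_gt0.
apply/nbhs_ballP; exists (r - `|w - c|) => //= w'; rewrite ball_distE /= => h.
rewrite -(subrK w w') -addrA; apply: (le_lt_trans (ler_normD _ _)).
by rewrite -ltrBrDr.
Qed.

Lemma open_cballC c r : open [set w | r < `|w - c|].
Proof.
rewrite openE => w /= wr; have d0 : 0 < `|w - c| - r by rewrite subr_gt0.
apply/nbhs_ballP; exists (`|w - c| - r) => //= w'; rewrite ball_distE /= => h.
have : `|w - c| <= `|w' - w| + `|w' - c|.
  by rewrite [`|w' - w|]distrC; apply: le_trans (ler_normD _ _); rewrite addrA subrK.
lra.
Qed.

Lemma compact_cball c r : compact (cball c r).
Proof.
have -> : cball c r = `[c.1 - r, c.1 + r] `*` `[c.2 - r, c.2 + r].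
  apply/seteqP; split=> w; rewrite /cball /= norm_pair_le /= !in_itv /=.
    by rewrite !ler_distl => /andP[].
  by case; rewrite !ler_distl => -> ->.
by apply: compact_setX; exact: segment_compact.
Qed.

Lemma cball_tangent_mono p u r s : `|u| <= 1 -> r <= s ->
  cball (p + r *: u) r `<=` cball (p + s *: u) s.
Proof.
move=> u1 rs w; rewrite /cball /= => h.
have -> : w - (p + s *: u) = (w - (p + r *: u)) + (r - s) *: u.
  by plane_ring.
apply: (le_trans (ler_normD _ _)); rewrite normrZ [`|r - s|]distrC ger0_norm ?subr_ge0//.
have : (s - r) * `|u| <= s - r by rewrite ler_piMr// subr_ge0.
lra.
Qed.

Definition seg x y : set C := (fun t : R => x + t *: (y - x)) @` `[0, 1].

Lemma continuous_line (x v : C) : continuous (fun t : R => x + t *: v).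
Proof.
apply: continuous_forP => t; apply: (@continuous_pair _ _ (fun t => x.1 + t * v.1) (fun t => x.2 + t * v.2));
  (apply: cvgD; first exact: cvg_cst); by apply: cvgM; [exact: cvg_id|exact: cvg_cst].
Qed.

Lemma compact_seg x y : compact (seg x y).
Proof.
apply: continuous_compact; last exact: segment_compact.
by apply: continuous_subspaceT; exact: continuous_line.
Qed.

Lemma connected_seg x y : connected (seg x y).
Proof.
apply: connected_continuous_connected; first exact: segment_connected.
by apply: continuous_subspaceT; exact: continuous_line.
Qed.

Lemma seg_l x y : seg x y x.
Proof. by exists 0; rewrite /= ?in_itv/= ?lexx ?ler01// scale0r addr0. Qed.

Lemma seg_r x y : seg x y y.
Proof. by exists 1; rewrite /= ?in_itv/= ?lexx ?ler01// scale1r addrC subrK. Qed.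

Lemma seg_ball c r x y : ball c r x -> ball c r y -> seg x y `<=` ball c r.
Proof.
by move=> hx hy w [t t01 <-]; apply: ball_segment => //; move: t01; rewrite /= in_itv.
Qed.

Lemma cball_segment c r x y t : 0 <= t <= 1 ->
  cball c r x -> cball c r y -> cball c r (x + t *: (y - x)).
Proof.
rewrite /cball /= => /andP[t0 t1] hx hy.
have -> : x + t *: (y - x) - c = (1 - t) *: (x - c) + t *: (y - c).
  by rewrite !scale_pairE; apply: pair_ext => /=; ring.
apply: (le_trans (ler_normD _ _)); rewrite !normrZ !ger0_norm//; last lra.
nra.
Qed.

Lemma connected_ball c r : connected (ball c r).
Proof.
have [r0|r0] := lerP r 0.
  suff -> : ball c r = set0 by exact: connected0.
  by rewrite -subset0 ball_distE => w /=; rewrite ltNge (le_trans r0).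
have -> : ball c r = \bigcup_(y in ball c r) seg c y.
  apply/seteqP; split=> [y hy|y [x hx]]; first by exists y => //; exact: seg_r.
  by apply: seg_ball => //; exact: ballxx.
apply: bigcup_connected; first by exists c => y _; exact: seg_l.
by move=> y _; exact: connected_seg.
Qed.

(** Compactness lets a link survive a small move of the square that it avoids; connectedness is
    enough for the crosscut argument. *)
Definition linked O x y := exists K, [/\ compact K, connected K, K `<=` O, K x & K y].

Lemma linked_sym O x y : linked O x y -> linked O y x.
Proof. by move=> [K [? ? ? ? ?]]; exists K. Qed.

Lemma linked_trans O x y z : linked O x y -> linked O y z -> linked O x z.
Proof.
move=> [K [cK nK KO Kx Ky]] [L [cL nL LO Ly Lz]]; exists (K `|` L); split.
- exact: compactU.
- by apply: connectedU => //; exists y.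
- by rewrite subUset.
- by left.
- by right.
Qed.

Lemma linked_near O x : open O -> O x -> \forall y \near x, linked O x y.
Proof.
move=> oO Ox; have /nbhs_ballP[r /= r0 rO] := open_nbhs_nbhs (conj oO Ox).
apply/nbhs_ballP; exists r => //= y yr; exists (seg x y); split.
- exact: compact_seg.
- exact: connected_seg.
- by apply: subset_trans rO; apply: seg_ball => //; exact: ballxx.
- exact: seg_l.
- exact: seg_r.
Qed.

Lemma linked_connected O E x y : open O -> connected E -> E `<=` O -> E x -> E y ->
  linked O x y.
Proof.
move=> oO cE EO Ex Ey; have lx := linked_near oO.
suff : E `<=` [set z | O z /\ linked O x z] by move=> /(_ _ Ey)[].
apply: (@connected_two_open _ _ _ [set z | O z /\ ~ linked O x z] x) => //.
- rewrite openE => z [Oz lz]; near=> w; split; first by near: w; exact: open_nbhs_nbhs.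
  by apply: linked_trans lz _; near: w; exact: lx.
- rewrite openE => z [Oz lz]; near=> w; split; first by near: w; exact: open_nbhs_nbhs.
  move=> lw; apply: lz; apply: linked_trans lw (linked_sym _).
  by near: w; exact: lx.
- move=> z /EO Oz; have [h|h] := pselect (linked O x z); [by left|by right].
- by rewrite -subset0 => z [[_ [_ ?]] [_ ?]].
- by split; [exact: EO|exact: nbhs_singleton (lx _ (EO _ Ex))].
Unshelve. all: end_near. Qed.

Lemma compact_thicken K O : compact K -> open O -> K `<=` O ->
  exists2 r, 0 < r & forall x, K x -> ball x r `<=` O.
Proof.
move=> /compact_near_coveringP cK oO KO.
have : \forall r \near (0 : R)^'+, K `<=` (fun x => ball x r `<=` O).
  apply: (cK _ _ (fun r x => ball x r `<=` O)) => x Kx.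
  have /nbhs_ballP[d /= d0 dO] := open_nbhs_nbhs (conj oO (KO _ Kx)).
  have d20 : 0 < d / 2 by rewrite divr_gt0.
  exists (ball x (d / 2), [set r : R | 0 < r < d / 2]).
    split; first exact: nbhsx_ballx.
    by near=> r => /=; apply/andP; split.
  move=> [x' r] /= [hx /andP[r0 rd]] w hw; apply: dO.
  rewrite [d]splitr; apply: ball_triangle hx _.
  by move: hw; rewrite !ball_distE /= => hw; exact: lt_trans hw rd.
move=> h; have [r [r0 hr]] : exists r : R, 0 < r /\ K `<=` (fun x => ball x r `<=` O).
  apply: (@filter_ex _ (0 : R)^'+); near=> r; split => //.
  by near: r.
by exists r.
Unshelve. all: end_near. Qed.

Lemma compact_cball_avoid M q r : compact M -> (forall w, M w -> r < `|w - q|) ->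
  \forall x \near (q, r), forall w, M w -> x.2 < `|w - x.1|.
Proof.
move=> /compact_near_coveringP cM h.
apply: (cM _ (nbhs (q, r)) (fun (x : C * R) w => x.2 < `|w - x.1|)) => w Mw.
have c : {for (w, (q, r)), continuous (fun x : C * (C * R) => `|x.1 - x.2.1| - x.2.2)}.
  apply: cvgB; last by apply: (@continuous_comp _ _ _ snd snd); exact: cvg_snd.
  apply: cvg_norm; apply: cvgB; first exact: cvg_fst.
  by apply: (@continuous_comp _ _ _ snd fst); [exact: cvg_snd|exact: cvg_fst].
have h0 : 0 < `|w - q| - r by rewrite subr_gt0; exact: h.
apply: filterS (cvgr_gt _ c _ h0) => x /=.
by rewrite subr_gt0.
Qed.

(* [y] can be brought to the boundary point [c + s u] of the ball of radius [s],
   radially at the end, inside [O] and outside the closed ball. *)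
Definition adherent O c s y u := exists2 l, s < l &
  (forall m, s <= m <= l -> O (c + m *: u)) /\
  linked (O `&` [set w | s < `|w - c|]) y (c + l *: u).

(** Otherwise the points linked to [y] off the closed ball would be open and closed relative to [E],
    and would include [c]. *)
Lemma adherent_exists O E c s y : open O -> connected E -> E `<=` O -> E c -> E y ->
  0 < s -> s < `|y - c| -> exists2 u, `|u| = 1 & adherent O c s y u.
Proof.
move=> oO cE EO Ec Ey s0 ys; apply: contrapT => noadh.
have oU : open (O `&` [set w | s < `|w - c|]) by apply: openI => //; exact: open_cballC.
set U := (X in open X) in oU.
have Uy : U y by split => //; exact: EO.
have : E `<=` [set w | U w /\ linked U y w].
  apply: (@connected_two_open _ _ _ [set w | O w /\ ~ (U w /\ linked U y w)] y) => //.
  - rewrite openE => w [Uw lw]; near=> w'; split; first by near: w'; exact: open_nbhs_nbhs.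
    by apply: linked_trans lw _; near: w'; exact: linked_near.
  - rewrite openE => w [Ow nw]; have [ws|ws] := ltrP s (`|w - c|).
      have Uw : U w by [].
      near=> w'; split; first by near: w'; exact: open_nbhs_nbhs.
      move=> [Uw' lw']; apply: nw; split => //; apply: linked_trans lw' (linked_sym _).
      by near: w'; exact: linked_near.
    have /nbhs_ballP[d /= d0 dO] := open_nbhs_nbhs (conj oO Ow).
    have d20 : 0 < d / 2 by rewrite divr_gt0.
    apply/nbhs_ballP; exists (d / 2) => //= w'; rewrite ball_distE /= => hw'; split.
      by apply: dO; rewrite ball_distE /=; lra.
    move=> [[Ow' /= w's] lw']; apply: noadh.
    (* Since [w] lies in the closed ball, the radial segment from [w'] down to the sphere is no
       longer than |w' - w| < d / 2, hence stays in [ball w d]. *)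
    set D := `|w' - c| in w's.
    have D0 : 0 < D by exact: lt_trans w's.
    have uE : c + D *: (D^-1 *: (w' - c)) = w'.
      by rewrite scalerA divff ?gt_eqF// scale1r addrC subrK.
    have u1 : `|D^-1 *: (w' - c)| = 1 by rewrite normrZ normfV gtr0_norm// mulVf// gt_eqF.
    exists (D^-1 *: (w' - c)) => //.
    exists D => //; split; last by rewrite uE.
    move=> m /andP[sm mD]; apply: dO; rewrite ball_distE /=.
    have -> : c + m *: (D^-1 *: (w' - c)) - w = (m - D) *: (D^-1 *: (w' - c)) + (w' - w).
      by rewrite -[X in _ + (X - w)]uE; set v := D^-1 *: _; plane_ring.
    apply: (le_lt_trans (ler_normD _ _)); rewrite normrZ u1 mulr1 [`|m - D|]distrC ger0_norm ?subr_ge0//.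
    have : D <= `|w' - w| + `|w - c|.
      by rewrite /D; apply: le_trans (ler_normD _ _); rewrite addrA subrK.
    lra.
  - move=> w /EO Ow; have [h|h] := pselect (U w /\ linked U y w); [by left|by right].
  - by rewrite -subset0 => w [[_ ?] [_ ?]].
  - by split => //; exact: nbhs_singleton (linked_near oU Uy).
by move=> /(_ _ Ec) [[_ /=]]; rewrite subrr normr0 ltNge ltW.
Unshelve. all: end_near. Qed.

Lemma adherentW O V c s y u : O `<=` V -> adherent O c s y u -> adherent V c s y u.
Proof.
move=> OV [l sl [h [K [? ? KO ? ?]]]]; exists l => //; split.
  by move=> m /h /OV.
exists K; split => //; apply: subset_trans KO _; exact: setSI.
Qed.

Lemma adherent_in O c s y u : adherent O c s y u -> O (c + s *: u).
Proof. by move=> [l sl [h _]]; apply: h; rewrite lexx ltW. Qed.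

Lemma bounded_set_norm Om : bounded_set Om -> exists B, forall w, Om w -> `|w| <= B.
Proof.
move=> [B [Br h]]; exists (B + 1) => w Ow; apply: (h (B + 1)) => //.
by rewrite ltrDl ltr01.
Qed.

(** The bound on |u| covers both uses: [u = 0] gives the maximal square centred at [p], a unit
    vector the maximal square touching another one at [p]. *)
Lemma tangent_ball_max Om p u : open Om -> bounded_set Om -> Om p -> `|u| <= 1 ->
  exists r, [/\ 0 < r, ball (p + r *: u) r `<=` Om,
    exists2 z, cball (p + r *: u) r z & ~ Om z &
    forall s, r < s -> exists2 z, ball (p + s *: u) s z & ~ Om z].
Proof.
move=> oOm /bounded_set_norm[B bB] Omp u1.
pose A := [set r | 0 < r /\ ball (p + r *: u) r `<=` Om].
have Ab : has_sup A.
  split.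
    have /nbhs_ballP[d /= d0 dO] := open_nbhs_nbhs (conj oOm Omp).
    exists (d / 2); split; first by rewrite divr_gt0.
    apply: subset_trans dO => w; rewrite !ball_distE /= => h.
    have -> : w - p = w - (p + (d / 2) *: u) + (d / 2) *: u.
      by plane_ring.
    apply: (le_lt_trans (ler_normD _ _)); rewrite normrZ gtr0_norm ?divr_gt0//.
    have : d / 2 * `|u| <= d / 2 by rewrite ler_piMr// divr_ge0// ltW.
    lra.
  (* Two opposite points halfway to the corners lie in [Om] at distance [r] from each other. *)
  exists (2 * B) => r [r0 rO].
  have nh : `|((r / 2, r / 2) : C)| = r / 2.
    by rewrite prod_normE /= maxxx gtr0_norm// divr_gt0.
  have r2 : r / 2 < r by lra.
  have h1 : `|p + r *: u + (r / 2, r / 2)| <= B.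
    by apply: bB; apply: rO; rewrite ball_distE /= addrAC subrr add0r nh.
  have h2 : `|p + r *: u - (r / 2, r / 2)| <= B.
    by apply: bB; apply: rO; rewrite ball_distE /= addrAC subrr add0r normrN nh.
  have : `|((r, r) : C)| <= 2 * B.
    have -> : (r, r) = (p + r *: u + (r / 2, r / 2)) - (p + r *: u - (r / 2, r / 2)) :> C.
      by rewrite scale_pairE; apply: pair_ext => /=; field.
    by apply: (le_trans (ler_normB _ _)); lra.
  by rewrite prod_normE /= maxxx gtr0_norm.
pose r := sup A.
have rA s : A s -> s <= r by move=> As; apply: ub_le_sup => //; case: Ab.
have r0 : 0 < r.
  by have [s As] := Ab.1; apply: lt_le_trans (rA s As); case: As.
have rO : ball (p + r *: u) r `<=` Om.
  move=> w; rewrite ball_distE /= => h.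
  have e0 : 0 < (r - `|w - (p + r *: u)|) / 2 by rewrite divr_gt0// subr_gt0.
  have [s As sr] := sup_adherent e0 Ab; rewrite -/r in sr.
  have [s0 sO] := As; apply: sO; rewrite ball_distE /=.
  have -> : w - (p + s *: u) = (w - (p + r *: u)) + (r - s) *: u.
    by plane_ring.
  apply: (le_lt_trans (ler_normD _ _)); rewrite normrZ ger0_norm ?subr_ge0 ?rA//.
  have : (r - s) * `|u| <= r - s by rewrite ler_piMr// subr_ge0 rA.
  lra.
have rmax s : r < s -> exists2 z, ball (p + s *: u) s z & ~ Om z.
  move=> rs; apply: contrapT => h; move: (rs); apply/negP; rewrite -leNgt; apply: rA.
  split; first exact: lt_trans rs.
  by move=> z hz; apply: contrapT => Oz; apply: h; exists z.
exists r; split => //.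
(* A closed ball inside [Om] would have room [d] around it, enough for the tangent ball of radius r
   + d / 4. *)
apply: contrapT => h.
have cO : cball (p + r *: u) r `<=` Om.
  by move=> z hz; apply: contrapT => Oz; apply: h; exists z.
have [d d0 dO] := compact_thicken (@compact_cball _ _) oOm cO.
have [|z hz] := rmax (r + d / 4); first lra.
rewrite ball_distE /= in hz; apply.
set q := p + r *: u in dO.
have zq : `|z - q| < r + d / 2.
  have -> : z - q = z - (p + (r + d / 4) *: u) + (d / 4) *: u by rewrite /q; plane_ring.
  apply: (le_lt_trans (ler_normD _ _)); rewrite normrZ gtr0_norm ?divr_gt0//.
  have : d / 4 * `|u| <= d / 4 by rewrite ler_piMr// divr_ge0// ltW.
  lra.
have s0 : 0 < r + d / 2 by lra.
(* Contracting [z] towards [q] by [t] reaches the closed ball and moves [z] by less than [d], as (1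
   - t) (r + d / 2) = d / 2. *)
pose t := r / (r + d / 2).
have t0 : 0 <= t by rewrite divr_ge0// ltW.
have ts : t * (r + d / 2) = r by rewrite mulfVK// gt_eqF.
have t1 : t <= 1 by rewrite ler_pdivrMr// mul1r; lra.
apply: (dO (q + t *: (z - q))).
  rewrite /cball /= addrAC subrr add0r normrZ ger0_norm// -[leRHS]ts.
  by rewrite ler_wpM2l// ltW.
rewrite ball_distE /=.
have -> : z - (q + t *: (z - q)) = (1 - t) *: (z - q) by plane_ring.
rewrite normrZ ger0_norm ?subr_ge0//.
have : (1 - t) * `|z - q| <= (1 - t) * (r + d / 2) by rewrite ler_wpM2l ?subr_ge0// ltW.
nra.
Qed.

End PlaneTopology.

(** * Squares tangent to a square *)

Section SquareSeparation.
Variable R : realType.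
Notation C := (R * R)%type.
Implicit Types (c p q u v w y z a : C) (d k l m r s t x rho : R) (O Om E K M : set C).

Lemma scaled_dir_inj k a (k2 : k ^+ 2 = 1) (a1 : `|a| = 1) c l m s t :
  0 < l -> 0 <= m -> -1 < s < 1 -> -1 <= t <= 1 ->
  c + l *: dir k a s = c + m *: dir k a t -> s = t.
Proof.
move=> l0 m0 s1 t1 /addrI e; have lm : l = m.
  have := congr1 Num.norm e.
  by rewrite (normrZ l) (normrZ m) !norm_dir// !mulr1 gtr0_norm// ger0_norm.
by move: e; rewrite lm => /scalerI h; apply: (dir_inj k2 a1 s1 t1); apply: h; rewrite -lm gt_eqF.
Qed.

(** Arcs of radius rho / 2 and radial arms on both sides would join [y] to both sides of the
    midpoint of [c, p] without meeting the crosscut. The root [g3] stays abstract to allow two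
    endings: through a tangent square when [p] is in [Om], and [z = p] when it is not. *)
Lemma opposite_sides_not_linked Om O k a c rho s1 s s2 y z (g3 : C -> C) :
  k ^+ 2 = 1 -> `|a| = 1 -> open Om -> simply_connected Om -> 0 < rho ->
  ball c rho `<=` Om -> ~ Om (c + rho *: a) -> ~ Om z -> O `<=` Om ->
  -1 < s1 -> s1 < s -> s < s2 -> s2 < 1 ->
  adherent O c rho y (dir k a s1) -> adherent O c rho y (dir k a s2) ->
  continuous g3 ->
  (forall w, g3 w != 0 -> branch (ratio (c + rho *: dir k a s) z w) (g3 w)) ->
  (forall w, g3 w = 0 -> rho <= `|w - c| /\ ~ O w) -> False.
Proof.
move=> k2 a1 oOm scOm rho0 SOm aOm zOm OOm s1l s1s ss2 s2r A1 A2 cg3 bg3 g30.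
set e := dir k a.
have en t : `|e t| = 1 by exact: norm_dir.
have ea : e 1 = a by exact: dir1.
have ce : continuous e by exact: continuous_dir.
have s_in : -1 < s < 1 by lra.
have [s_l s_r] := andP s_in.
have s_in' : -1 <= s <= 1 by rewrite !ltW.
have one_in : -1 <= (1 : R) <= 1 by lra.
pose p := c + rho *: e s.
pose good w := Om w /\ [/\ half_dir (ratio (c + rho *: a) c w) != 0, half_dir (ratio c p w) != 0 & g3 w != 0].
have ray_good m t : 0 < m -> -1 < t < 1 -> t != s -> m < rho \/ O (c + m *: e t) ->
    good (c + m *: e t).
  move=> m0 t1 ts h; set w := c + m *: e t.
  have wn : `|w - c| = m by rewrite /w addrAC subrr add0r normrZ en mulr1 gtr0_norm.
  split.
    by case: h => [h|/OOm//]; apply: SOm; rewrite ball_distE /= wn.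
  split.
  - apply/eqP => /half_dir_ratio_eq0[x x01]; rewrite -ea.
    have -> : c + rho *: e 1 + x *: (c - (c + rho *: e 1)) = c + ((1 - x) * rho) *: e 1.
      by set v := e 1; plane_ring.
    move=> /(scaled_dir_inj k2 a1 m0 _ t1) t1E.
    have tE : t = 1.
      by apply: t1E => //; rewrite mulr_ge0 ?subr_ge0 ?(ltW rho0)//; case/andP: x01.
    by move: t1; rewrite tE ltxx andbF.
  - apply/eqP => /half_dir_ratio_eq0[x x01]; rewrite /p.
    have -> : c + x *: (c + rho *: e s - c) = c + (x * rho) *: e s.
      by set v := e s; plane_ring.
    move=> /(scaled_dir_inj k2 a1 m0 _ t1) t1E.
    have tE : t = s.
      by apply: t1E => //; rewrite mulr_ge0 ?(ltW rho0)//; case/andP: x01.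
    by move: ts; rewrite tE eqxx.
  - apply/eqP => /g30; rewrite wn => -[mr wO]; case: h => //.
    by rewrite ltNge mr.
have seg_in v x : `|v| = 1 -> 0 <= x <= 1 -> `|x *: (rho *: v)| <= rho.
  move=> v1 x01; rewrite !normrZ v1 mulr1 ger0_norm; last lra.
  by rewrite gtr0_norm//; nra.
have out_good w : O w -> rho < `|w - c| -> good w.
  move=> Ow wr; split; first exact: OOm.
  split.
  - apply/eqP => /half_dir_ratio_eq0[x x01] wE; move: wr; apply/negP; rewrite -leNgt wE.
    have -> : c + rho *: a + x *: (c - (c + rho *: a)) - c = (1 - x) *: (rho *: a) by plane_ring.
    by apply: seg_in => //; lra.
  - apply/eqP => /half_dir_ratio_eq0[x x01] wE; move: wr; apply/negP; rewrite -leNgt wE /p.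
    have -> : c + x *: (c + rho *: e s - c) - c = x *: (rho *: e s).
      by set v := e s; plane_ring.
    exact: seg_in.
  - by apply/eqP => /g30[].
have carm v : continuous (fun m : R => c + m *: v) by exact: continuous_line.
have carc : continuous (fun t : R => c + (rho / 2) *: e t).
  apply: continuous_forP => t.
  apply: (@continuous_pair _ _ (fun t => c.1 + (rho / 2) * (e t).1) (fun t => c.2 + (rho / 2) * (e t).2));
  (apply: cvgD; first exact: cvg_cst); (apply: cvgM; first exact: cvg_cst).
    exact: (continuous_fst (ce t)).
  exact: (continuous_snd (ce t)).
have rho2 : 0 < rho / 2 < rho by lra.
(* [arc], [arm] and [K] join the vicinity of the midpoint of [c, p] to [y] on one side *)
have side (I : set R) t : connected I -> I t -> (forall x, I x -> -1 < x < 1 /\ x != s) ->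
    adherent O c rho y (e t) ->
    exists E, [/\ connected E, E y, E `<=` good & forall x, I x -> E (c + (rho / 2) *: e x)].
  move=> cI It Ib [l rl [hl [K [cK nK KO Ky Kl]]]].
  pose arc := (fun t : R => c + (rho / 2) *: e t) @` I.
  pose arm := (fun m : R => c + m *: e t) @` `[rho / 2, l].
  have carc' : connected arc.
    by apply: connected_continuous_connected => //; exact: continuous_subspaceT.
  have carm' : connected arm.
    by apply: connected_continuous_connected; [exact: segment_connected|exact: continuous_subspaceT].
  exists (arc `|` arm `|` K); split.
  - apply: connectedU => //; last first.
      apply: connectedU => //; exists (c + (rho / 2) *: e t); split; first by exists t.
      by exists (rho / 2) => //=; rewrite in_itv /=; lra.
    exists (c + l *: e t); split => //; right; exists l => //=; rewrite in_itv /=; lra.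
  - by right.
  - move=> w [[[x Ix <-]|[x /=]]|/KO[Ow wr]].
    + by have [xb xs] := Ib x Ix; apply: ray_good => //; [by case/andP: rho2|by left; case/andP: rho2].
    + rewrite in_itv /= => xI <-; have [tb ts] := Ib t It.
      have [x0 xl] := andP xI; apply: ray_good => //.
        by case/andP: rho2 => h _; exact: lt_le_trans h x0.
      have [|xr] := ltrP x rho; [by left|right].
      by apply: hl; rewrite xr xl.
    + exact: out_good.
  - by move=> x Ix; left; left; exists x.
have [E1 [cE1 E1y E1g E1a]] : exists E, [/\ connected E, E y, E `<=` good &
    forall x, `]-1, s[%classic x -> E (c + (rho / 2) *: e x)].
  apply: (side _ s1) => //.
  - exact/connected_intervalP/interval_is_interval.
  - by rewrite /= in_itv /= s1l.
  - by move=> x; rewrite /= in_itv /= => /andP[xl xr]; split; [rewrite xl (lt_trans xr)|rewrite lt_eqF].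
have [E2 [cE2 E2y E2g E2a]] : exists E, [/\ connected E, E y, E `<=` good &
    forall x, `]s, 1[%classic x -> E (c + (rho / 2) *: e x)].
  apply: (side _ s2) => //.
  - exact/connected_intervalP/interval_is_interval.
  - by rewrite /= in_itv /= ss2.
  - by move=> x; rewrite /= in_itv /= => /andP[xl xr]; split; [rewrite xr (lt_trans s_l)|rewrite gt_eqF].
have mE : c + 2^-1 *: (p - c) = c + (rho / 2) *: e s.
  by rewrite /p; set v := e s; rewrite !scale_pairE; apply: pair_ext => /=; field.
apply: (@crosscut_separates _ Om (E1 `|` E2) g3 (c + rho *: a) c p z) => //.
- apply/eqP => cp; have := congr1 Num.norm cp; rewrite /p => /eqP.
  have : p - c = 0 by rewrite -cp subrr.
  rewrite /p addrAC subrr add0r => /(congr1 Num.norm).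
  by rewrite normrZ en mulr1 normr0 => /eqP; rewrite normr_eq0 gt_eqF.
- rewrite mE; apply: SOm; rewrite ball_distE /= addrAC subrr add0r normrZ en mulr1.
  by case/andP: rho2 => h1 h2; rewrite gtr0_norm.
- rewrite mE; apply/eqP => /half_dir_ratio_eq0[x x01]; rewrite -ea.
  have -> : c + rho *: e 1 + x *: (c - (c + rho *: e 1)) = c + ((1 - x) * rho) *: e 1.
    by set v := e 1; plane_ring.
  have rho20 : 0 < rho / 2 by case/andP: rho2.
  move=> /(scaled_dir_inj k2 a1 rho20 _ s_in) h.
  have sE : s = 1.
    by apply: h => //; rewrite mulr_ge0 ?subr_ge0 ?(ltW rho0)//; case/andP: x01.
  by move: s_r; rewrite sE ltxx.
- rewrite mE; apply/eqP => /g30[h _]; move: h.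
  rewrite addrAC subrr add0r normrZ en mulr1.
  by case/andP: rho2 => h1 h2; rewrite gtr0_norm// leNgt h2.
- by apply: connectedU => //; exists y.
- by move=> w [/E1g|/E2g] [].
- by move=> w [/E1g|/E2g] [].
- move=> N; rewrite mE => hN.
  have h1 : \forall t \near s, N (c + (rho / 2) *: e t) by exact: (carc s _ hN).
  have h2 : \forall t \near s, 0 < half_dot t s.
    have cc : {for s, continuous (fun t => half_dot t s)}.
      apply: (@continuous_comp _ _ _ (fun t : R => (t, s)) (fun x : R * R => half_dot x.1 x.2)).
        by apply: continuous_pair; [exact: cvg_id|exact: cvg_cst].
      exact: continuous_half_dot.
    exact: (cvgr_gt _ cc _ (half_dot_gt0 s)).
  (* The imaginary part of [ratio c p w] is the cross product of w - c and p - c. *)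
  have sgn t : -1 < t < 1 -> 0 < half_dot t s -> exists2 x, 0 < x &
      k * (ratio c p (c + (rho / 2) *: e t)).2 = x * (t - s).
    move=> t1 th.
    have [x x0 xE] := cross_dir_sign k2 a1 th (one_plus_mul_gt0 t1 s_in').
    exists (rho ^+ 2 / 2 * x); first by rewrite mulr_gt0// divr_gt0// exprn_gt0.
    have -> : rho ^+ 2 / 2 * x * (t - s) = rho ^+ 2 / 2 * (x * (t - s)) by ring.
    rewrite -xE /ratio /p -/e /cross; set v := e t; set v' := e s.
    by rewrite !scale_pairE /=; field.
  have [x1 [x1I N1 h1']] : exists x, [/\ -1 < x < s, N (c + (rho / 2) *: e x) & 0 < half_dot x s].
    apply: (@filter_ex _ (s^'-)); near=> t; split.
    + by apply/andP; split; near: t; [exact: nbhs_left_gt s_l|exact: nbhs_left_lt].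
    + by near: t; move: h1; apply: filterS => x hx _.
    + by near: t; move: h2; apply: filterS => x hx _.
  have [x2 [x2I N2 h2']] : exists x, [/\ s < x < 1, N (c + (rho / 2) *: e x) & 0 < half_dot x s].
    apply: (@filter_ex _ (s^'+)); near=> t; split.
    + by apply/andP; split; near: t; [exact: nbhs_right_gt|exact: nbhs_right_lt s_r].
    + by near: t; move: h1; apply: filterS => x hx _.
    + by near: t; move: h2; apply: filterS => x hx _.
  have [x1l x1s] := andP x1I; have [sx2 x2r] := andP x2I.
  have i1 : -1 < x1 < 1 by rewrite x1l (lt_trans x1s).
  have i2 : -1 < x2 < 1 by rewrite x2r (lt_trans s_l).
  have [d1 d10 e1] := sgn x1 i1 h1'; have [d2 d20 e2] := sgn x2 i2 h2'.
  have f1 : k * (ratio c p (c + (rho / 2) *: e x1)).2 < 0 by rewrite e1 pmulr_rlt0// subr_lt0.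
  have f2 : 0 < k * (ratio c p (c + (rho / 2) *: e x2)).2 by rewrite e2 pmulr_rgt0// subr_gt0.
  have g1 : (E1 `|` E2) (c + (rho / 2) *: e x1) by left; apply: E1a; rewrite /= in_itv.
  have g2 : (E1 `|` E2) (c + (rho / 2) *: e x2) by right; apply: E2a; rewrite /= in_itv.
  have /orP[/eqP kE|/eqP kE] : (k == 1) || (k == -1) by rewrite -sqrf_eq1 k2.
  + rewrite kE !mul1r in f1 f2.
    by exists (c + (rho / 2) *: e x2), (c + (rho / 2) *: e x1).
  + rewrite kE !mulN1r in f1 f2; rewrite oppr_lt0 in f1; rewrite oppr_gt0 in f2.
    by exists (c + (rho / 2) *: e x1), (c + (rho / 2) *: e x2).
Unshelve. all: end_near. Qed.

End SquareSeparation.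

(** * Sliding the tangent squares *)

Section TangentSquares.
Variable R : realType.
Notation C := (R * R)%type.
Implicit Types (c p q u v w y z a : C) (b d k l m r s t x rho : R) (O Om E K M : set C).

Lemma ball_tangent_mono p u r s : `|u| <= 1 -> r <= s ->
  ball (p + r *: u) r `<=` ball (p + s *: u) s.
Proof.
move=> u1 rs w; rewrite !ball_distE /= => h.
have -> : w - (p + s *: u) = (w - (p + r *: u)) + (r - s) *: u by plane_ring.
apply: (le_lt_trans (ler_normD _ _)); rewrite normrZ [`|r - s|]distrC ger0_norm ?subr_ge0//.
have : (s - r) * `|u| <= s - r by rewrite ler_piMr// subr_ge0.
lra.
Qed.

Lemma cball_tangent_outside c rho u r w : 0 < rho -> 0 <= r -> `|u| = 1 ->
  cball (c + rho *: u + r *: u) r w -> rho <= `|w - c|.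
Proof.
move=> rho0 r0 u1; rewrite /cball /= => h.
have e : `|(rho + r) *: u| = rho + r by rewrite normrZ u1 mulr1 ger0_norm//; lra.
have : `|(rho + r) *: u| <= `|w - c| + `|w - (c + rho *: u + r *: u)|.
  by apply: le_trans (ler_normB _ _); rewrite le_eqVlt; apply/orP; left; apply/eqP; congr `|_|; plane_ring.
lra.
Qed.

(** At x = b the left side is - r g(b), at most [r]. If this is strict, it persists nearby; equality
    means g(b) = -1, and then g(x) >= -1 gives the bound at every [x]. *)
Lemma near_tangent_coord (g : R -> R) b rho r : 0 < rho -> 0 < r ->
  {for b, continuous g} -> (forall x, `|g x| <= 1) ->
  \forall x \near b, rho * g b - (rho + r) * g x <= r.
Proof.
move=> rho0 r0 cg g1; have [gb|gb] := eqVneq (g b) (-1).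
  near=> x; have := g1 x; rewrite ler_norml => /andP[gx _]; rewrite gb; nra.
have gb1 : -1 < g b by move: (g1 b); rewrite ler_norml => /andP[h _]; rewrite lt_neqAle eq_sym gb.
have cc : {for b, continuous (fun x => rho * g b - (rho + r) * g x)}.
  by apply: cvgB; [exact: cvg_cst|apply: cvgM => //; exact: cvg_cst].
have h : rho * g b - (rho + r) * g b < r by nra.
by apply: filterS (cvgr_lt _ cc _ h) => x /ltW.
Unshelve. all: end_near. Qed.

(** A square of fixed radius touching at [e x] contains the contact point of [e b] once [x] is close
    to [b]. Round discs touching from outside share a single point, so this is special to
    squares. *)
Lemma near_tangent (e : R -> C) b rho r : 0 < rho -> 0 < r -> continuous e ->
  (forall x, `|e x| = 1) ->
  \forall x \near b, `|rho *: e b - (rho *: e x + r *: e x)| <= r.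
Proof.
move=> rho0 r0 ce e1.
have c1 : {for b, continuous (fun x => (e x).1)} by exact: (continuous_fst (ce b)).
have c2 : {for b, continuous (fun x => (e x).2)} by exact: (continuous_snd (ce b)).
have n x : `|(e x).1| <= 1 /\ `|(e x).2| <= 1.
  by have := lexx (`|e x|); rewrite {2}e1 norm_pair_le => /andP[].
have h1 := near_tangent_coord rho0 r0 c1 (fun x => (n x).1).
have h2 := near_tangent_coord rho0 r0 c2 (fun x => (n x).2).
have h3 : \forall x \near b, rho * - (e b).1 - (rho + r) * - (e x).1 <= r.
  apply: (@near_tangent_coord (fun x => - (e x).1)) => //; first exact: cvgN.
  by move=> x; rewrite normrN; case: (n x).
have h4 : \forall x \near b, rho * - (e b).2 - (rho + r) * - (e x).2 <= r.
  apply: (@near_tangent_coord (fun x => - (e x).2)) => //; first exact: cvgN.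
  by move=> x; rewrite normrN; case: (n x).
near=> x.
have : rho * (e b).1 - (rho + r) * (e x).1 <= r by near: x.
have : rho * (e b).2 - (rho + r) * (e x).2 <= r by near: x.
have : rho * - (e b).1 - (rho + r) * - (e x).1 <= r by near: x.
have : rho * - (e b).2 - (rho + r) * - (e x).2 <= r by near: x.
rewrite norm_pair_le !scale_pairE /= !ler_norml => f4 f3 f2 f1.
by apply/andP; split; apply/andP; split; lra.
Unshelve. all: end_near. Qed.

Variables (Om : set C) (c : C) (rho : R) (a y : C).
Hypotheses (oOm : open Om) (scOm : simply_connected Om).
Hypotheses (rho0 : 0 < rho) (SOm : ball c rho `<=` Om).
Hypotheses (a1 : `|a| = 1) (aOm : ~ Om (c + rho *: a)).

Variable r : C -> R.
Let q u := c + rho *: u + r u *: u.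
Let O u := Om `&` [set w | r u < `|w - q u|].
Hypothesis r_max : forall u, `|u| = 1 -> Om (c + rho *: u) ->
  [/\ 0 < r u, ball (q u) (r u) `<=` Om, exists2 z, cball (q u) (r u) z & ~ Om z &
    forall s, r u < s -> exists2 z, ball (c + rho *: u + s *: u) s z & ~ Om z].

Section Orientation.
Variable k : R.
Hypothesis k2 : k ^+ 2 = 1.
Let e := dir k a.
Let T x := Om (c + rho *: e x).

Let en x : `|e x| = 1. Proof. exact: norm_dir. Qed.

Let contact u : `|u| = 1 -> 0 < r u -> cball (q u) (r u) (c + rho *: u).
Proof.
move=> u1 ru; rewrite /cball /= /q opprD addrA subrr add0r normrN normrZ u1 mulr1.
by rewrite gtr0_norm.
Qed.

(** The crosscut ends along the segments from [p] to the centre of the tangent square and on to [z].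
    By convexity both stay in the closed tangent square, hence off [O (e s)] and outside the ball
    about [c]. *)
Lemma tangent_separates s1 s s2 : -1 < s1 -> s1 < s -> s < s2 -> s2 < 1 -> T s ->
  adherent (O (e s)) c rho y (e s1) -> adherent (O (e s)) c rho y (e s2) -> False.
Proof.
move=> s1l s1s ss2 s2r Ts A1 A2.
have [r0 QOm [z zQ zOm] _] := r_max (en s) Ts.
pose p := c + rho *: e s.
pose g3 w := cmul (half_dir (ratio p (q (e s)) w)) (half_dir (ratio (q (e s)) z w)).
have pQ : cball (q (e s)) (r (e s)) p by exact: contact.
have qQ : cball (q (e s)) (r (e s)) (q (e s)) by rewrite /cball /= subrr normr0 ltW.
have cmul0 w w' : cmul w w' = 0 -> w = 0 \/ w' = 0.
  by move/eqP/negPn; rewrite cmul_neq0 negb_and !negbK => /orP[] /eqP; [left|right].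
apply: (@opposite_sides_not_linked _ Om (O (e s)) k a c rho s1 s s2 y z g3) => //.
- by move=> w [].
- apply: continuous_forP => w; apply: continuous_cmul; apply: continuous_half_dir; exact: continuous_ratio.
- move=> w; rewrite cmul_neq0 => /andP[h1 h2].
  have [_ wq] := half_dir_ratio_neq0 h1; rewrite -subr_eq0 in wq.
  apply: (branch_scaled (sqr_sum_gt0 wq)).
  have := branchM (half_dir_branch h1) (half_dir_branch h2); congr branch.
  by rewrite /ratio -/p; set Q := q (e s); set P := p; plane_ring.
- move=> w g0.
  have wQ : cball (q (e s)) (r (e s)) w.
    by case: (cmul0 _ _ g0) => /half_dir_ratio_eq0[t t01 ->]; exact: cball_segment.
  split; first by apply: cball_tangent_outside wQ => //; exact: ltW.
  by move=> [_ /=]; rewrite ltNge (wQ : _ <= _).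
Qed.

(** If the contact point [p] were outside [Om], the broken line from [a] through [c] to [p] would
    already be a crosscut. With [z = p] the last quotient is positive, so its root can be taken
    real. *)
Lemma adherent_interval s1 s s2 : -1 < s1 -> s2 < 1 -> s1 <= s <= s2 ->
  adherent Om c rho y (e s1) -> adherent Om c rho y (e s2) -> T s.
Proof.
move=> s1l s2r /andP[]; rewrite le_eqVlt => /orP[/eqP <- _ /adherent_in//|s1s].
rewrite le_eqVlt => /orP[/eqP -> _ /adherent_in//|ss2] A1 A2.
apply: contrapT => nTs; pose p := c + rho *: e s.
pose g3 w : C := ((w - p).1 ^+ 2 + (w - p).2 ^+ 2, 0).
have cp : continuous (fun w => w - p) by move=> w; apply: cvgB; [exact: cvg_id|exact: cvg_cst].
have g3p w : g3 w != 0 -> w - p != 0.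
  by apply: contra => /eqP h; rewrite /g3 h; apply/eqP/pair_ext => //=; rewrite expr0n addr0.
apply: (@opposite_sides_not_linked _ Om Om k a c rho s1 s s2 y p g3) => //.
- apply: continuous_forP => w; apply: continuous_pair; last exact: cvg_cst.
  have c1 := continuous_fst (cp w); have c2 := continuous_snd (cp w).
  by apply: cvgD; apply: cvgM.
- move=> w /g3p /sqr_sum_gt0 h; set N := _ + _ in h.
  have -> : g3 w = N *: (1, 0) by rewrite scale_pairE /= mulr1 mulr0.
  apply: branchZ; first by rewrite gt_eqF.
  apply: branch_trivial; last by rewrite /ratio /=; ring.
  by rewrite /ratio /= mulrN opprK; move: h; rewrite /N /= !expr2.
- move=> w g0; have wp : w = p.
    apply/eqP; rewrite -subr_eq0; apply: contraT => /sqr_sum_gt0.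
    by move/(congr1 fst): g0 => /= ->; rewrite ltxx.
  by rewrite wp; split => //; rewrite /p addrAC subrr add0r normrZ en mulr1 gtr0_norm.
Qed.

Let continuous_scaled_dir s : continuous (fun x => c + rho *: e x + s *: e x).
Proof.
have ce : continuous e by exact: continuous_dir.
apply: continuous_forP => x.
apply: (@continuous_pair _ _ (fun x => c.1 + rho * (e x).1 + s * (e x).1)
  (fun x => c.2 + rho * (e x).2 + s * (e x).2)).
  have c1 := continuous_fst (ce x).
  by apply: cvgD; [apply: cvgD; [exact: cvg_cst|]|]; apply: cvgM => //; exact: cvg_cst.
have c1 := continuous_snd (ce x).
by apply: cvgD; [apply: cvgD; [exact: cvg_cst|]|]; apply: cvgM => //; exact: cvg_cst.
Qed.

(** A tangent ball slightly larger than the maximal one contains a point off [Om], and still does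
    after a small move of the contact point. So the nearby maximal squares lie in slightly enlarged
    ones, and these miss the compact [M]. *)
Lemma adherent_stable x v : T x -> adherent (O (e x)) c rho y v ->
  \forall x' \near x, T x' -> adherent (O (e x')) c rho y v.
Proof.
move=> Tx [l rl [hl [K [cK nK KO Ky Kl]]]].
have [r0 _ _ rmax] := r_max (en x) Tx.
pose M := K `|` (fun m => c + m *: v) @` `[rho, l].
have cM : compact M.
  apply: compactU => //; apply: continuous_compact; last exact: segment_compact.
  by apply: continuous_subspaceT; exact: continuous_line.
have MO w : M w -> O (e x) w.
  by case=> [/KO[]//|[m /=]]; rewrite in_itv /= => /hl h <-.
have /(compact_cball_avoid cM)/nbhs_ballP[d /= d0 near_qr] :
  forall w, M w -> r (e x) < `|w - q (e x)| by move=> w /MO[].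
pose s := r (e x) + d / 4.
have rs : r (e x) < s by rewrite /s; lra.
have near_c : \forall x' \near x, `|(c + rho *: e x + s *: e x) - (c + rho *: e x' + s *: e x')| < d / 4.
  have := @continuous_scaled_dir s x; move/cvgrPdist_lt => /(_ (d / 4)); apply.
  by rewrite divr_gt0.
have [z zs zOm] := rmax s rs.
have near_z : \forall x' \near x, ball (c + rho *: e x' + s *: e x') s z.
  have cz : {for x, continuous (fun x' => `|z - (c + rho *: e x' + s *: e x')|)}.
    by apply: cvg_norm; apply: cvgB; [exact: cvg_cst|exact: continuous_scaled_dir].
  move: zs; rewrite ball_distE /= => zs.
  by apply: filterS (cvgr_lt _ cz _ zs) => x' h; rewrite ball_distE.
near=> x' => Tx'.
have [r0' QOm' _ _] := r_max (en x') Tx'.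
have rs' : r (e x') <= s.
  rewrite leNgt; apply/negP => sr; apply: zOm; apply: QOm'.
  by apply: (ball_tangent_mono _ (ltW sr)); [rewrite en|near: x'].
have MO' w : M w -> O (e x') w.
  move=> Mw; split; first by case: (MO w Mw).
  rewrite /= ltNge; apply/negP => h.
  have : cball (c + rho *: e x' + s *: e x') s w.
    by apply: (cball_tangent_mono _ rs' h); rewrite en.
  rewrite /cball /=; apply/negP; rewrite -ltNge.
  apply: (near_qr (c + rho *: e x' + s *: e x', s)) => //; split => /=; last first.
    by rewrite /ball /= /s opprD addrA subrr add0r normrN gtr0_norm ?divr_gt0//; lra.
  rewrite ball_distE /= distrC.
  have -> : q (e x) - (c + rho *: e x' + s *: e x') =
    ((c + rho *: e x + s *: e x) - (c + rho *: e x' + s *: e x')) - (d / 4) *: e x.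
    by rewrite /q /s; set f := e x; set f' := e x'; plane_ring.
  apply: (le_lt_trans (ler_normB _ _)); rewrite normrZ en mulr1 gtr0_norm ?divr_gt0//.
  have : `|(c + rho *: e x + s *: e x) - (c + rho *: e x' + s *: e x')| < d / 4 by near: x'.
  lra.
exists l => //; split.
  by move=> m hm; apply: MO'; right; exists m => //; rewrite /= in_itv.
exists K; split => // w Kw; split; first by apply: MO'; left.
by have [] := KO w Kw.
Unshelve. all: end_near. Qed.

Hypothesis not_separated : forall u, `|u| = 1 -> Om (c + rho *: u) ->
  exists2 v, `|v| = 1 & adherent (O u) c rho y v.

Let not_separated_side x : -1 < x < 1 -> T x ->
  exists x', [/\ -1 < x' < 1, x' != x & adherent (O (e x)) c rho y (e x')].
Proof.
move=> x1 Tx; have [v v1 A] := not_separated (en x) Tx.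
have [vO vq] := adherent_in A.
have va : v != a by apply: contra_notN aOm => /eqP <-.
have [x' x'1 eE] := dir_surj k2 a1 v1 va.
exists x'; split => //; last by rewrite /e eE.
apply: contraTneq (vq : _ < _) => xx; rewrite -eE xx -leNgt.
by apply: contact => //; have [] := r_max (en x) Tx.
Qed.

(* Sliding the tangent squares from [s0] towards the first point [b] outside
   [Om]: [y] stays on the side of [b], but near [b] the squares are too small
   to separate [y] from [s0]. *)
Lemma tangent_square_sweep s0 s1 : -1 < s0 -> s0 < s1 -> s1 < 1 ->
  adherent Om c rho y (e s0) -> adherent (O (e s0)) c rho y (e s1) -> False.
Proof.
move=> s0l s01 s1r A0 A01.
have ce : continuous e by exact: continuous_dir.
have cP : continuous (fun x => c + rho *: e x).
  have -> : (fun x => c + rho *: e x) = (fun x => c + rho *: e x + 0 *: e x).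
    by apply/funext => x; rewrite scale0r addr0.
  exact: continuous_scaled_dir.
have T_near x : T x -> \forall x' \near x, T x'.
  by move=> Tx; exact: (cP x Om (open_nbhs_nbhs (conj oOm Tx))).
pose I := [set x | s0 <= x <= 1 /\ forall x', s0 <= x' <= x -> T x'].
have T0 : T s0 by exact: adherent_in A0.
have supI : has_sup I.
  split; last by exists 1 => x [] /andP[].
  exists s0; split; first by rewrite lexx/=; lra.
  by move=> x' x'1; have -> : x' = s0 by lra.
pose b := sup I.
have T1 : ~ T 1 by rewrite /T /e dir1.
have b1 : b <= 1 by apply: ge_sup; [case: supI|move=> x [] /andP[]].
have hJ x : s0 <= x -> x < b -> T x.
  move=> s0x xb; have xb0 : 0 < b - x by rewrite subr_gt0.
  have [x1 [_ h] x1b] := sup_adherent xb0 supI; rewrite -/b in x1b.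
  by apply: h; rewrite s0x /=; lra.
have s0b' : s0 <= b.
  apply: ub_le_sup; [by case: supI|split; first by rewrite lexx/=; lra].
  by move=> x' x'1; have -> : x' = s0 by lra.
have nTb : ~ T b.
  move=> Tb; have bn1 : b < 1 by rewrite lt_neqAle b1 andbT; apply/eqP => bE; apply: T1; rewrite -bE.
  have /nbhs_ballP[d /= d0 dT] := T_near _ Tb.
  have [x [xb x1 xd]] : exists x, [/\ b < x, x <= 1 & x < b + d].
    exists (Num.min 1 (b + d / 2)); split.
    - by rewrite lt_min bn1 ltrDl divr_gt0.
    - by rewrite ge_min lexx.
    - by rewrite gt_min; apply/orP; right; lra.
  have : x <= b.
    apply: ub_le_sup; [by case: supI|split; first by lra].
    move=> x' /andP[s0x' x'x]; have [x'b|bx'] := ltrP x' b; first exact: hJ.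
    by apply: dT; rewrite /ball /= ltr_norml; lra.
  lra.
have s0b : s0 < b by rewrite lt_neqAle s0b' andbT; apply/eqP => bE; apply: nTb; rewrite -bE.
pose Right x := exists2 x', x < x' < 1 & adherent (O (e x)) c rho y (e x').
pose Left x := exists2 x', -1 < x' < x & adherent (O (e x)) c rho y (e x').
have J_right : `[s0, b[%classic `<=` [set x | (-1 < x < 1 /\ T x) /\ Right x].
  have near_in x : -1 < x < 1 -> T x -> \forall x' \near x, -1 < x' < 1 /\ T x'.
    move=> /andP[x0 x1] Tx; near=> x'; split; last by near: x'; exact: T_near.
    by apply/andP; split; near: x'; [exact: lt_nbhsr|exact: lt_nbhsl].
  apply: (@connected_two_open _ _ _ [set x | (-1 < x < 1 /\ T x) /\ Left x] s0).
  - exact/connected_intervalP/interval_is_interval.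
  - rewrite openE => x [[x1 Tx] [x' /andP[xx' x'1] A]].
    near=> x''; have [x''1 Tx''] : -1 < x'' < 1 /\ T x'' by near: x''; exact: near_in.
    split => //; exists x'.
      by rewrite x'1 andbT; near: x''; exact: lt_nbhsl.
    by move: Tx''; near: x''; exact: adherent_stable.
  - rewrite openE => x [[x1 Tx] [x' /andP[x'1 xx'] A]].
    near=> x''; have [x''1 Tx''] : -1 < x'' < 1 /\ T x'' by near: x''; exact: near_in.
    split => //; exists x'.
      by rewrite x'1 /=; near: x''; exact: lt_nbhsr.
    by move: Tx''; near: x''; exact: adherent_stable.
  - move=> x; rewrite /= in_itv /= => /andP[s0x xb].
    have x1 : -1 < x < 1 by lra.
    have Tx := hJ x s0x xb.
    have [x' [x'1 xx' A]] := not_separated_side x1 Tx.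
    have [h|h|h] := ltgtP x' x; last by rewrite h eqxx in xx'.
      by right; split => //; exists x' => //; rewrite h andbT; case/andP: x'1.
    by left; split => //; exists x' => //; rewrite h /=; case/andP: x'1.
  - rewrite -subset0 => x [[_ [[_ Tx] [x2 /andP[h2 h2'] A2]]] [_ [x3 /andP[h3 h3'] A3]]].
    exact: (tangent_separates h3 h3' h2 h2' Tx A3 A2).
  - by rewrite /= in_itv /= lexx.
  - split; first by split => //; lra.
    by exists s1 => //; rewrite s01.
(* The contact point where [y] is reached cannot lie at or past [b]: together with the one at [s0]
   it would put [b] in [Om]. *)
have beyond x : s0 <= x -> x < b -> exists x', [/\ x < x', x' < b & r (e x) < `|c + rho *: e x' - q (e x)|].
  move=> s0x xb; have [_ [x' /andP[xx' x'1] A]] : [set x | (-1 < x < 1 /\ T x) /\ Right x] x.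
    by apply: J_right; rewrite /= in_itv /= s0x.
  have [_ out] := adherent_in A.
  exists x'; split => //; rewrite ltNge; apply/negP => bx'; apply: nTb.
  apply: (@adherent_interval s0 b x') => //; first by rewrite ltW.
  by apply: adherentW A => w [].
have [l rl [hl [K [cK nK KO Ky Kl]]]] := A0.
pose M := K `|` (fun m => c + m *: e s0) @` `[rho, l].
have cM : compact M.
  apply: compactU => //; apply: continuous_compact; last exact: segment_compact.
  by apply: continuous_subspaceT; exact: continuous_line.
have MO : M `<=` Om.
  by move=> w [/KO[]//|[m /=]]; rewrite in_itv /= => /hl h <-.
have [d d0 dM] := compact_thicken cM oOm MO.
have d40 : 0 < d / 4 by rewrite divr_gt0.
have near_b : \forall x \near b, cball (c + rho *: e x + (d / 4) *: e x) (d / 4) (c + rho *: e b).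
  apply: filterS (near_tangent b rho0 d40 ce en) => x.
  by rewrite /cball /=; congr (`|_| <= _); set f := e x; set f' := e b; plane_ring.
have near_P : \forall x \near b, `|c + rho *: e b - (c + rho *: e x)| < d / 4.
  by have := cP b; move/cvgrPdist_lt => /(_ _ d40).
(* Parameters this close to [b] satisfy the angle conditions of [dir_between]. *)
have [d' d'0 hhd] : exists2 d' : R, 0 < d' & forall x x', `|b - x| < d' -> `|b - x'| < d' -> 0 < half_dot x x'.
  have h : {for (b, b), continuous (fun x : R * R => half_dot x.1 x.2)} by exact: continuous_half_dot.
  have : nbhs (b, b) [set x : R * R | 0 < half_dot x.1 x.2] by exact: (cvgr_gt _ h _ (half_dot_gt0 b)).
  move=> /nbhs_ballP[d' /= d'0 near_bb].
  by exists d' => // x x' hx hx'; apply: (near_bb (x, x')).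
have [x [s0x xb xb' [xd hP]]] : exists x, [/\ s0 < x, x < b, `|b - x| < d' &
    cball (c + rho *: e x + (d / 4) *: e x) (d / 4) (c + rho *: e b) /\
    `|c + rho *: e b - (c + rho *: e x)| < d / 4].
  apply: (@filter_ex _ (b^'-)); near=> x; split.
  - by near: x; exact: nbhs_left_gt.
  - by near: x; exact: nbhs_left_lt.
  - have xb : x < b by near: x; exact: nbhs_left_lt.
    have : b - d' < x by near: x; apply: nbhs_left_gt; rewrite ltrBlDr ltrDl.
    by rewrite gtr0_norm ?subr_gt0// ltrBlDr ltrBlDl addrC.
  - by split; near: x; [move: near_b|move: near_P]; apply: filterS => x hx _.
have [_ [x2 /andP[xx2 x21] A2]] : [set x | (-1 < x < 1 /\ T x) /\ Right x] x.
  by apply: J_right; rewrite /= in_itv /= xb ltW.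
have Tx := hJ x (ltW s0x) xb.
have [r0 _ _ _] := r_max (en x) Tx.
(* A small square stays within [d] of the contact point of [b], which is outside [Om]; so it misses
   [M], and [y] is reached on the left at [s0] as well as on the right. *)
have [rd|dr] := ltrP (r (e x)) (d / 4).
  have MOx w : M w -> O (e x) w.
    move=> Mw; split; first exact: MO.
    rewrite /= ltNge; apply/negP => h; apply: nTb; apply: (dM _ Mw).
    rewrite ball_distE /=.
    have -> : c + rho *: e b - w = (c + rho *: e b - (c + rho *: e x)) - r (e x) *: e x - (w - q (e x)).
      by rewrite /q; set f := e x; set f' := e b; plane_ring.
    apply: (le_lt_trans (ler_normB _ _)).
    have : `|c + rho *: e b - (c + rho *: e x) - r (e x) *: e x| < d / 4 + d / 4.
      apply: (le_lt_trans (ler_normB _ _)); rewrite normrZ en mulr1 gtr0_norm//; exact: ltrD.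
    lra.
  apply: (tangent_separates s0l s0x xx2 x21 Tx _ A2).
  exists l => //; split.
    by move=> m hm; apply: MOx; right; exists m => //; rewrite /= in_itv.
  exists K; split => // w Kw; split; first by apply: MOx; left.
  by have [] := KO w Kw.
(* A large closed square contains the contact points of [x] and [b], hence the point where their
   chord meets the ray of [x']. That point is at distance at most [rho] from [c], and at least [rho]
   since it lies in the tangent square; so it is the contact point of [x'], contrary to [out]. *)
have [x' [xx' x'b out]] := beyond x (ltW s0x) xb.
have bQ : cball (q (e x)) (r (e x)) (c + rho *: e b).
  by apply: (cball_tangent_mono _ dr xd); rewrite en.
have xQ : cball (q (e x)) (r (e x)) (c + rho *: e x) by exact: contact.
have d'x' : `|b - x'| < d' by move: xb'; rewrite !gtr0_norm ?subr_gt0//; apply: lt_trans; rewrite ltrD2l ltrN2.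
have d'b : `|b - b| < d' by rewrite subrr normr0.
have xl : -1 < x by exact: lt_trans s0x.
have x'l : -1 < x' by exact: lt_trans xx'.
have x'r : x' < 1 by exact: lt_le_trans b1.
have x1 : -1 < x < 1 by rewrite xl (lt_trans xx').
have x'1 : -1 < x' < 1 by rewrite x'l.
have bb : -1 <= b <= 1 by rewrite b1 ltW// (lt_trans x'l).
have x'1' : -1 <= x' <= 1 by rewrite !ltW.
have xx'b : x < x' < b by rewrite xx'.
have [l1 [m1 [l10 m10 eE]]] := dir_between k2 a1 xx'b (hhd _ _ xb' d'x') (hhd _ _ d'x' d'b)
  (hhd _ _ xb' d'b) (one_plus_mul_gt0 x1 x'1') (one_plus_mul_gt0 x'1 bb) (one_plus_mul_gt0 x1 bb).
rewrite -/e in eE.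
have lm : 0 < l1 + m1 by rewrite addr_gt0.
have lm1 : 1 <= l1 + m1.
  rewrite -(en x') eE; apply: (le_trans (ler_normD _ _)).
  by rewrite (normrZ l1) (normrZ m1) !en !mulr1 !gtr0_norm.
pose t := m1 / (l1 + m1).
have t01 : 0 <= t <= 1.
  apply/andP; split; first by rewrite divr_ge0// ltW.
  by rewrite ler_pdivrMr// mul1r lerDr ltW.
have X := cball_segment t01 xQ bQ.
have XE : c + rho *: e x + t *: (c + rho *: e b - (c + rho *: e x)) = c + (rho / (l1 + m1)) *: e x'.
  rewrite eE /t; set f := e x; set f' := e b; rewrite !scale_pairE; apply: pair_ext => /=; field;
  by rewrite gt_eqF.
rewrite XE in X.
have := cball_tangent_outside rho0 (ltW r0) (en x) X.
rewrite addrAC subrr add0r (normrZ (rho / _)) en mulr1 gtr0_norm ?divr_gt0//.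
rewrite ler_pdivlMr// ger_pMr// => lm1'.
have lmE : l1 + m1 = 1 by apply/eqP; rewrite eq_le lm1'.
move: X; rewrite lmE divr1 /cball /= => X.
by move: out; rewrite ltNge X.
Unshelve. all: end_near. Qed.

End Orientation.
End TangentSquares.

(** * The square separation theorem *)

Section Separation.
Variable R : realType.
Notation C := (R * R)%type.
Implicit Types (c p q u v w y z a : C) (d k l m r s t x rho : R) (O Om E K M A B D W : set C).

Definition separates Om q r y c :=
  forall E, connected E -> E `<=` Om -> (forall w, E w -> r < `|w - q|) -> E y -> ~ E c.

Lemma square_separation Om c rho a y :
  open Om -> connected Om -> simply_connected Om -> bounded_set Om ->
  0 < rho -> ball c rho `<=` Om -> cball c rho a -> ~ Om a -> Om y -> rho < `|y - c| ->
  exists q r, [/\ 0 < r /\ ball q r `<=` Om, rho + r <= `|q - c|,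
    exists2 p, Om p & cball c rho p /\ cball q r p,
    exists2 z, cball q r z & ~ Om z & cball q r y \/ separates Om q r y c].
Proof.
move=> oOm cOm scOm bOm rho0 SOm aS aOm Oy yS; apply: contrapT => none.
have Oc : Om c by apply: SOm; exact: ballxx.
have ac : `|a - c| = rho.
  apply/eqP; rewrite eq_le (aS : _ <= _) /= leNgt; apply/negP => h; apply: aOm.
  by apply: SOm; rewrite ball_distE.
pose a0 := rho^-1 *: (a - c).
have a01 : `|a0| = 1 by rewrite normrZ normfV gtr0_norm// ac mulVf// gt_eqF.
have a0E : c + rho *: a0 = a by rewrite scalerA divff ?gt_eqF// scale1r addrC subrK.
have a0Om : ~ Om (c + rho *: a0) by rewrite a0E.
pose spec u r := [/\ 0 < r, ball (c + rho *: u + r *: u) r `<=` Om,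
    exists2 z, cball (c + rho *: u + r *: u) r z & ~ Om z &
    forall s, r < s -> exists2 z, ball (c + rho *: u + s *: u) s z & ~ Om z].
have [r r_max] : exists r : C -> R, forall u, `|u| = 1 -> Om (c + rho *: u) -> spec u (r u).
  have /choice[r hr] u : exists r, `|u| = 1 -> Om (c + rho *: u) -> spec u r.
    have [[u1 Ou]|h] := pselect (`|u| = 1 /\ Om (c + rho *: u)).
      have u1' : `|u| <= 1 by rewrite u1.
      by have [r hr] := tangent_ball_max oOm bOm Ou u1'; exists r.
    by exists 0 => u1 Ou; case: h.
  by exists r.
pose q u := c + rho *: u + r u *: u.
pose O u := Om `&` [set w | r u < `|w - q u|].
(* If the tangent square at [u] does not separate, a connected set joins [y] to [c] off it; its
   first approach to the ball about [c] gives the adherence. *)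
have nosep u : `|u| = 1 -> Om (c + rho *: u) ->
    exists2 v, `|v| = 1 & adherent (O u) c rho y v.
  move=> u1 Ou; have [r0 QOm zQ _] := r_max u u1 Ou.
  have qc : `|c - q u| = rho + r u.
    have -> : c - q u = - ((rho + r u) *: u) by rewrite /q; plane_ring.
    by rewrite normrN normrZ u1 mulr1 gtr0_norm// addr_gt0.
  have [E [cE [EOm EQ] Ey Ec]] : exists E, [/\ connected E,
      E `<=` Om /\ (forall w, E w -> r u < `|w - q u|), E y & E c].
    apply: contrapT => h; apply: none; exists (q u), (r u); split => //.
    - by rewrite distrC qc.
    - exists (c + rho *: u) => //; split.
        by rewrite /cball /= addrAC subrr add0r normrZ u1 mulr1 gtr0_norm.
      by rewrite /cball /= /q opprD addrA subrr add0r normrN normrZ u1 mulr1 gtr0_norm.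
    - by right => E cE EOm EQ Ey Ec; apply: h; exists E.
  apply: (@adherent_exists _ (O u) E) => //.
  - by apply: openI => //; exact: open_cballC.
  - by move=> w Ew; split; [exact: EOm|exact: EQ].
have [u0 u01 A0] := adherent_exists oOm cOm (@subset_refl _ Om) Oc Oy rho0 yS.
have not_a u : Om (c + rho *: u) -> u != a0 by move=> Ou; apply: contra_notN a0Om => /eqP <-.
have Ou0 := adherent_in A0.
have [u1 u11 A1] := nosep u0 u01 Ou0.
have [Ou1 u1Q] := adherent_in A1.
have u10 : u1 != u0.
  apply: contraTneq (u1Q : _ < _) => ->; rewrite -leNgt /q opprD addrA subrr add0r normrN.
  have [r0 _ _ _] := r_max u0 u01 Ou0.
  by rewrite normrZ u01 mulr1 gtr0_norm.
have [s0 s0I e0] := dir_surj (expr1n _ 2) a01 u01 (not_a _ Ou0).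
have [s1 s1I e1] := dir_surj (expr1n _ 2) a01 u11 (not_a _ Ou1).
have [s01|s01|s01] := ltgtP s0 s1; last by move: u10; rewrite -e0 -e1 s01 eqxx.
  apply: (@tangent_square_sweep _ Om c rho a0 y oOm scOm rho0 SOm a01 a0Om r r_max 1 (expr1n _ 2) nosep s0 s1); rewrite ?e0 ?e1//; lra.
(* The remaining order of [s0] and [s1] is the mirror image: reversing the orientation changes the
   parameters to their opposites. *)
have k2 : (-1) ^+ 2 = 1 :> R by rewrite sqrrN expr1n.
have eN s : dir (-1) a0 (- s) = dir 1 a0 s by rewrite dir_opp opprK.
by apply: (@tangent_square_sweep _ Om c rho a0 y oOm scOm rho0 SOm a01 a0Om r r_max (-1) k2 nosep (- s0) (- s1)); rewrite ?eN ?e0 ?e1//; lra.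
Qed.

End Separation.

(** * Chains of separating squares *)

Section Sides.
Variable R : realType.
Notation C := (R * R)%type.
Implicit Types (c p q u v w y z a : C) (d k l m r s t x rho : R) (O Om E K M A B D W : set C).

(** The assumptions force [P] to have the sign of [W], so adding a multiple of [P] moves [W] away
    from 0. *)
Lemma coord_outward (P W m d : R) : 0 < d -> 0 <= m -> d < `|W| -> `|W - P| < d ->
  d < `|W + m * P|.
Proof.
move=> d0 m0; rewrite !lter_normr ltr_norml => /orP[h|h] /andP[h1 h2]; apply/orP; [left|right]; nra.
Qed.

(** At a boundary point [p] of the square, nearby points off the closed square can be pushed along p
    - c without meeting it until they enter one ball [H] touching the square at [p]. This works at
    corners too. *)
Lemma local_side Om c rho p : open Om -> 0 < rho -> Om p ->
  exists2 d, 0 < d & exists W, [/\ connected W, W `<=` Om,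
    forall w, W w -> rho < `|w - c| &
    forall w, `|w - p| < d -> rho < `|w - c| -> W w].
Proof.
move=> oOm rho0 Op.
have /nbhs_ballP[d /= d0 dO] := open_nbhs_nbhs (conj oOm Op).
have [pr|pr|pr] := ltgtP (`|p - c|) rho.
- exists (rho - `|p - c|); first by rewrite subr_gt0.
  exists set0; split => //; first exact: connected0.
  move=> w h1 h2; have : `|w - c| <= `|w - p| + `|p - c|.
    by apply: le_trans (ler_normD _ _); rewrite addrA subrK.
  lra.
- have op : open (Om `&` [set w | rho < `|w - c|]) by apply: openI => //; exact: open_cballC.
  have /nbhs_ballP[d' /= d'0 h] := open_nbhs_nbhs (conj op (conj Op pr)).
  exists d' => //; exists (ball p d'); split.
  + exact: connected_ball.
  + by move=> w /h[].
  + by move=> w /h[].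
  + by move=> w h1 _; rewrite ball_distE.
(* The bound by [rho] is for [coord_outward]; the bound by d / 2 keeps [H] inside [ball p d]. *)
pose e := Num.min rho (d / 2).
have e0 : 0 < e by rewrite lt_min rho0 divr_gt0.
have er : e <= rho by rewrite ge_min lexx.
have ed : e <= d / 2 by rewrite ge_min lexx orbT.
pose u := rho^-1 *: (p - c).
have u1 : `|u| = 1 by rewrite normrZ normfV gtr0_norm// pr mulVf// gt_eqF.
pose N := [set w | `|w - p| < e /\ rho < `|w - c|].
have out w t : N w -> 0 <= t -> rho < `|w + t *: u - c|.
  move=> [wp wc] t0; move: wc; rewrite !ltNge; apply: contra.
  rewrite !norm_pair_le => /andP[h1 h2].
  have wp1 : `|(w - p).1| < rho /\ `|(w - p).2| < rho.
    have : `|w - p| <= `|w - p| := lexx _.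
    by rewrite {1}norm_pair_le => /andP[f1 f2]; split; lra.
  have tr : 0 <= t / rho by rewrite divr_ge0// ltW.
  have fE (W P : R) : `|W - P| < rho -> `|W + t * (rho^-1 * P)| <= rho -> `|W| <= rho.
    move=> WP; rewrite mulrA !leNgt; apply: contra => h; exact: coord_outward.
  apply/andP; split.
    apply: (fE _ (p - c).1).
      by have -> : (w - c).1 - (p - c).1 = (w - p).1 by [rewrite /=; ring]; case: wp1.
    by move: h1; rewrite /u !scale_pairE /=; congr (`|_| <= _); ring.
  apply: (fE _ (p - c).2).
    by have -> : (w - c).2 - (p - c).2 = (w - p).2 by [rewrite /=; ring]; case: wp1.
  by move: h2; rewrite /u !scale_pairE /=; congr (`|_| <= _); ring.
pose H := ball (p + e *: u) e.
have HN w : N w -> H (w + e *: u).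
  move=> [wp _]; rewrite /H ball_distE /=.
  by have -> : w + e *: u - (p + e *: u) = w - p by plane_ring.
have Hd w : H w -> `|w - p| < d.
  rewrite /H ball_distE /= => h; have -> : w - p = (w - (p + e *: u)) + e *: u by plane_ring.
  by apply: (le_lt_trans (ler_normD _ _)); rewrite normrZ u1 mulr1 gtr0_norm//; lra.
have Hc w : H w -> rho < `|w - c|.
  rewrite /H ball_distE /= => h.
  have : `|(rho + e) *: u| <= `|w - c| + `|w - (p + e *: u)|.
    apply: le_trans (ler_normB _ _); rewrite le_eqVlt; apply/orP; left; apply/eqP; congr (`|_|).
    have -> : p = c + rho *: u by rewrite scalerA divff ?gt_eqF// scale1r addrC subrK.
    by plane_ring.
  rewrite normrZ u1 mulr1 gtr0_norm; lra.
exists e => //; exists (\bigcup_(w in N) (H `|` seg w (w + e *: u)) `|` H); split.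
- have cH : connected H by exact: connected_ball.
  have Hp : H (p + e *: u) by exact: ballxx.
  have [[w0 Nw0]|nN] := pselect (exists w, N w); last first.
    suff -> : N = set0 by rewrite bigcup_set0 set0U.
    by rewrite -subset0 => w Nw; apply: nN; exists w.
  apply: connectedU => //.
    by exists (p + e *: u); split => //; exists w0 => //; left.
  apply: bigcup_connected; first by exists (p + e *: u) => w Nw; left.
  move=> w Nw; apply: connectedU => //; last exact: connected_seg.
  by exists (w + e *: u); split; [exact: HN|exact: seg_r].
- have HO w : H w -> Om w by move=> /Hd h; apply: dO; rewrite ball_distE.
  move=> w [[w' Nw' []]|]; [exact: HO| |exact: HO].
  move=> [t /=]; rewrite in_itv /= => /andP[t0 t1] <-; apply: dO; rewrite ball_distE /=.
  have -> : w' + t *: (w' + e *: u - w') - p = (w' - p) + (t * e) *: u by plane_ring.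
  apply: (le_lt_trans (ler_normD _ _)); case: Nw' => h _.
  rewrite normrZ u1 mulr1 ger0_norm; last by rewrite mulr_ge0// ltW.
  by have : t * e <= e by [rewrite ler_piMl// ltW]; lra.
- move=> w [[w' Nw' []]|]; [exact: Hc| |exact: Hc].
  move=> [t /=]; rewrite in_itv /= => /andP[t0 t1] <-.
  have -> : w' + t *: (w' + e *: u - w') = w' + (t * e) *: u by plane_ring.
  by apply: out => //; rewrite mulr_ge0// ltW.
- by move=> w h1 h2; left; exists w => //; right; exact: seg_l.
Qed.

(* Locally at any point, the complement of a square has only one side. *)
Lemma merge_at Om c rho p A B : open Om -> 0 < rho -> Om p ->
  connected A -> connected B -> A `<=` Om -> B `<=` Om ->
  (forall w, A w -> rho < `|w - c|) -> (forall w, B w -> rho < `|w - c|) ->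
  closure A p -> closure B p ->
  exists D, [/\ connected D, D `<=` Om, forall w, D w -> rho < `|w - c|, A `<=` D & B `<=` D].
Proof.
move=> oOm rho0 Op cA cB AO BO Ac Bc clA clB.
have [d d0 [W [cW WO Wc dW]]] := local_side c oOm rho0 Op.
have meet E : closure E p -> (forall w, E w -> rho < `|w - c|) -> exists2 w, E w & W w.
  move=> /(_ _ (nbhsx_ballx p d d0))[w [Ew wd]] Ec; exists w => //; apply: dW; last exact: Ec.
  by move: wd; rewrite ball_distE.
have [w1 Aw1 Ww1] := meet _ clA Ac; have [w2 Bw2 Ww2] := meet _ clB Bc.
exists (A `|` W `|` B); split.
- apply: connectedU => //; first by exists w2; split => //; right.
  by apply: connectedU => //; exists w1.
- by rewrite !subUset.
- by move=> w [[]|]; [exact: Ac|exact: Wc|exact: Bc].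
- by move=> w Aw; left; left.
- by move=> w Bw; right.
Qed.

End Sides.

(** * Nested components along a chain *)

Section Chain.
Variable R : realType.
Notation C := (R * R)%type.
Implicit Types (c p q u v w y z a : C) (d r s t x rho : R) (O Om E K M A B D W : set C).

Lemma dist_triangle p q w : `|q - p| <= `|w - p| + `|w - q|.
Proof.
have -> : q - p = (w - p) - (w - q) by plane_ring.
exact: ler_normB.
Qed.

Definition off Om q r : set C := Om `&` [set w | r < `|w - q|].

Lemma open_off Om q r : open Om -> open (off Om q r).
Proof. by move=> oOm; apply: openI => //; exact: open_cballC. Qed.

Lemma open_component O y : open O -> open (connected_component O y).
Proof.
move=> oO; rewrite openE => w yw; have Ow := connected_component_sub yw.
apply: filterS (linked_near oO Ow) => z [K [_ cK KO Kw Kz]].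
by apply: connected_component_trans yw _; exists K.
Qed.

Lemma open_disjoint_cball E q r : open E -> 0 < r ->
  (forall w, E w -> ball q r w -> False) -> forall w, E w -> r < `|w - q|.
Proof.
move=> oE r0 dis w Ew; rewrite ltNge; apply/negP => wr.
have : closure (ball q r) w by rewrite closure_ball_cball.
by move=> /(_ _ (open_nbhs_nbhs (conj oE Ew)))[w' [wr' Ew']]; exact: dis wr'.
Qed.

Lemma component_cball O y q r : open O -> 0 < r ->
  (forall w, ball q r w -> ~ connected_component O y w) ->
  forall w, connected_component O y w -> r < `|w - q|.
Proof.
move=> oO r0 dis; apply: open_disjoint_cball => //; first exact: open_component.
by move=> w h1 h2; exact: dis h2 h1.
Qed.

(** Only squares up to [N] are constrained, and the last may have [y] in its closure. The same
    results thus serve the final chain and the initial pieces of a hypothetical infinite one. *)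
Variables (Om : set C) (y : C) (ctr : nat -> C) (rad : nat -> R) (N : nat).
Hypotheses (oOm : open Om) (cOm : connected Om) (Oy : Om y).
Hypothesis rad_gt0 : forall m, (m <= N)%N -> 0 < rad m.
Let S m := ball (ctr m) (rad m).
Hypothesis S_sub : forall m, (m <= N)%N -> S m `<=` Om.
Hypothesis far : forall m, (m < N)%N -> rad m < `|y - ctr m|.
Hypothesis disjoint_succ : forall m, (m < N)%N -> rad m + rad m.+1 <= `|ctr m.+1 - ctr m|.
Hypothesis touch_succ : forall m, (m < N)%N ->
  exists2 p, Om p & cball (ctr m) (rad m) p /\ cball (ctr m.+1) (rad m.+1) p.
Hypothesis separates_succ : forall m, (m < N)%N ->
  cball (ctr m.+1) (rad m.+1) y \/ separates Om (ctr m.+1) (rad m.+1) y (ctr m).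

Let V m := off Om (ctr m) (rad m).
Let U m := connected_component (V m) y.

Let closureS m p : (m <= N)%N -> cball (ctr m) (rad m) p -> closure (S m) p.
Proof. by move=> mN; rewrite closure_ball_cball// rad_gt0. Qed.

Let S_ctr m : (m <= N)%N -> S m (ctr m).
Proof. by move=> mN; apply: ballxx; exact: rad_gt0. Qed.

Let Vy m : (m < N)%N -> V m y.
Proof. by move=> mN; split => //; exact: far. Qed.

Let Uy m : (m < N)%N -> U m y.
Proof. by move=> mN; apply: connected_component_refl; exact: Vy. Qed.

Let UV m : U m `<=` V m. Proof. exact: connected_component_sub. Qed.

Let U_max m E w : connected E -> E `<=` V m -> E w -> U m w -> E `<=` U m.
Proof.
move=> cE EV Ew Uw z Ez; apply: connected_component_trans Uw _.
by exists E.
Qed.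

Let far_separates m : (m.+1 < N)%N -> separates Om (ctr m.+1) (rad m.+1) y (ctr m).
Proof.
move=> mN; case: (separates_succ (ltnW mN)) => //.
by rewrite /cball /= leNgt far.
Qed.

Let S_succ_V m : (m < N)%N -> S m.+1 `<=` V m.
Proof.
move=> mN w Sw; split; first exact: S_sub Sw.
move: Sw; rewrite /S ball_distE /= => h.
have := dist_triangle (ctr m) (ctr m.+1) w.
have := disjoint_succ mN; lra.
Qed.

Let S_V_succ m : (m < N)%N -> S m `<=` V m.+1.
Proof.
move=> mN w Sw; split; first by apply: S_sub Sw; exact: ltnW.
move: Sw; rewrite /S ball_distE /= => h.
have := dist_triangle (ctr m) (ctr m.+1) w.
have := disjoint_succ mN; lra.
Qed.

(** If [y] is in the next closed square, merge at [y]. Otherwise suppose that the next square misses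
    [U m]. As [Om] is connected, [U m] has a boundary point in [Om], which must lie on the closed
    square [m]; merging there would join [y] to [ctr m] off the next square. *)
Let S_succ_U m : (m < N)%N -> S m.+1 `<=` U m.
Proof.
move=> mN; have mN' := ltnW mN; have r0 := rad_gt0 mN'; have r1 := rad_gt0 mN.
have cS i : connected (S i) by exact: connected_ball.
have [yQ|sep] := separates_succ mN.
  have [D [cD DO Dc yD QD]] : exists D, [/\ connected D, D `<=` Om,
      forall w, D w -> rad m < `|w - ctr m|, [set y] `<=` D & S m.+1 `<=` D].
    apply: (merge_at oOm r0 Oy) => //.
    - exact: connected1.
    - by move=> _ ->.
    - exact: S_sub.
    - by move=> _ ->; exact: far.
    - by move=> w /(S_succ_V mN)[].
    - by apply: subset_closure.
    - exact: closureS.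
  apply: subset_trans QD _; apply: (U_max cD _ (yD y erefl) (Uy mN)).
  by move=> w Dw; split; [exact: DO|exact: Dc].
apply: contrapT => nQ.
have UQ w : S m.+1 w -> ~ U m w.
  by move=> Sw Uw; apply: nQ; exact: U_max (S_succ_V mN) Sw Uw.
have oV : open (V m) by exact: open_off.
have UQ' := component_cball oV r1 UQ.
have [p Op [Up nUp]] : exists2 p, Om p & closure (U m) p /\ ~ U m p.
  apply: contrapT => none.
  have : Om `<=` U m.
    apply: (@connected_two_open _ _ _ (~` closure (U m)) y) => //.
    - exact: open_component.
    - exact/closed_openC/closed_closure.
    - move=> w Ow; have [h|h] := pselect (U m w); first by left.
      by right => cU; apply: none; exists w.
    - by rewrite -subset0 => w [[_ h] nh]; apply: nh; exact: subset_closure.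
    - exact: Uy.
  move=> /(_ _ (S_sub mN' (S_ctr mN')))/UV[_ /=].
  by rewrite subrr normr0 ltNge ltW.
have cU : connected (U m) by exact: component_connected.
have pS : cball (ctr m) (rad m) p.
  rewrite /cball /= leNgt; apply/negP => pr; apply: nUp.
  have [D [cD DO Dc UD pD]] : exists D, [/\ connected D, D `<=` Om,
      forall w, D w -> rad m < `|w - ctr m|, U m `<=` D & [set p] `<=` D].
    apply: (merge_at oOm r0 Op) => //.
    - exact: connected1.
    - by move=> w /UV[].
    - by move=> _ ->.
    - by move=> w /UV[].
    - by move=> _ ->.
    - by apply: subset_closure.
  apply: (U_max cD _ (UD _ (Uy mN)) (Uy mN)); last exact: pD.
  by move=> w Dw; split; [exact: DO|exact: Dc].
have [D [cD DO Dc UD SD]] : exists D, [/\ connected D, D `<=` Om,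
    forall w, D w -> rad m.+1 < `|w - ctr m.+1|, U m `<=` D & S m `<=` D].
  apply: (merge_at oOm r1 Op) => //.
  - by move=> w /UV[].
  - exact: S_sub.
  - by move=> w /(S_V_succ mN)[].
  - exact: closureS.
exact: (sep D cD DO Dc (UD _ (Uy mN)) (SD _ (S_ctr mN'))).
Qed.

(** Separation keeps [U m.+1] disjoint from [S m], and an open set disjoint from a square misses its
    closure. *)
Let U_succ m : (m.+1 < N)%N -> U m.+1 `<=` U m.
Proof.
move=> mN; have mN' := ltnW mN.
have dis w : S m w -> ~ U m.+1 w.
  move=> Sw Uw; have sep := far_separates mN.
  have cUS : connected (U m.+1 `|` S m).
    by apply: connectedU; [exists w|exact: component_connected|exact: connected_ball].
  have sub : U m.+1 `|` S m `<=` V m.+1.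
    by rewrite subUset; split; [exact: UV|exact: S_V_succ].
  apply: (sep _ cUS).
  - by move=> z /sub[].
  - by move=> z /sub[].
  - by left; exact: Uy.
  - by right; apply: S_ctr; exact: ltnW.
have oV : open (V m.+1) by exact: open_off.
have h := component_cball oV (rad_gt0 (ltnW mN')) dis.
apply: (@U_max m (U m.+1) y); [exact: component_connected| |exact: Uy|exact: Uy].
by move=> w Uw; split; [case: (UV Uw)|exact: h].
Qed.

Let U_mono i j : (i <= j)%N -> (j < N)%N -> U j `<=` U i.
Proof.
move=> ij; rewrite -(subnKC ij); elim: (j - i)%N => [|n IH]; first by rewrite addn0 => _ w.
rewrite addnS => h; move=> w Uw; apply: (IH (ltnW h)); exact: U_succ.
Qed.

Lemma chain_later_component i j : (i < j)%N -> (j <= N)%N -> S j `<=` U i.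
Proof.
case: j => // j; rewrite ltnS => ij jN; apply: subset_trans (S_succ_U jN) _.
exact: U_mono.
Qed.

Lemma chain_later_off i j : (i < j)%N -> (j <= N)%N -> S j `<=` V i.
Proof. by move=> ij jN w /(chain_later_component ij jN)/UV. Qed.

Lemma chain_earlier_off i j : (i < j)%N -> (j <= N)%N -> S i `<=` V j.
Proof.
move=> ij jN; have iN : (i <= N)%N by exact: leq_trans (ltnW ij) jN.
move=> w Sw; split; first exact: S_sub Sw.
apply: (@open_disjoint_cball (S i)) Sw; [exact: open_ball|exact: rad_gt0|].
move=> z Si /(chain_later_off ij jN)[_ /=].
by move: Si; rewrite /S ball_distE /= => h1 h2; have := lt_trans h1 h2; rewrite ltxx.
Qed.

Lemma chain_not_linked i E : (i.+1 < N)%N -> connected E -> E `<=` V i.+1 -> E y -> ~ E (ctr i).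
Proof.
move=> iN cE EV Ey; apply: (far_separates iN cE) => // w /EV[] //.
Qed.

(** Going down from [i], consecutive squares touch inside [Om] and are merged at the common point
    off the closed square [i.+1]. *)
Lemma chain_earlier_component i j : (j <= i)%N -> (i.+1 < N)%N ->
  S j `<=` connected_component (V i.+1) (ctr i).
Proof.
move=> ji iN; have iN' : (i <= N)%N by do 2 apply: ltnW.
rewrite -(subKn ji); have := leq_subr j i; elim: (i - j)%N => [|n IH] ni.
  rewrite subn0; apply: connected_component_max; first exact: S_ctr.
    by apply: chain_earlier_off => //; exact: ltnW.
  exact: connected_ball.
have ni' : (i - n.+1 < N)%N by rewrite (leq_ltn_trans (leq_subr _ _))// (ltn_trans _ iN).
have nS : (i - n = (i - n.+1).+1)%N by rewrite subnS prednK// subn_gt0.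
have [p Op [p1 p2]] := touch_succ ni'; rewrite -nS in p2.
have nN : (i - n <= N)%N by rewrite (leq_trans (leq_subr _ _)).
have V1 : S (i - n.+1)%N `<=` V i.+1.
  by apply: chain_earlier_off => //; rewrite ?ltnS ?leq_subr// ltnW.
have V2 : S (i - n)%N `<=` V i.+1.
  by apply: chain_earlier_off => //; rewrite ?ltnS ?leq_subr// ltnW.
have [D [cD DO Dc D1 D2]] : exists D, [/\ connected D, D `<=` Om,
    forall w, D w -> rad i.+1 < `|w - ctr i.+1|, S (i - n.+1)%N `<=` D & S (i - n)%N `<=` D].
  apply: (merge_at oOm (rad_gt0 (ltnW iN)) Op).
  - exact: connected_ball.
  - exact: connected_ball.
  - by move=> w /V1[].
  - by move=> w /V2[].
  - by move=> w /V1[].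
  - by move=> w /V2[].
  - by apply: closureS => //; exact: ltnW.
  - exact: closureS.
move=> w /D1 Dw; apply: (connected_component_trans (IH (ltnW ni) _ (S_ctr nN))).
exists D => //; split => //; first exact/D2/S_ctr.
by move=> z Dz; split; [exact: DO|exact: Dc].
Qed.

(** Merging at a common point would join [ctr i] to [S j], hence to [y], off the closed square
    [i.+1]. *)
Lemma chain_nonadjacent i j : (i.+1 < j)%N -> (j <= N)%N ->
  cball (ctr i) (rad i) `&` cball (ctr j) (rad j) `&` Om = set0.
Proof.
move=> ij jN; rewrite -subset0 => p [[pi pj] Op].
have iN : (i.+1 < N)%N by exact: leq_trans jN.
have iN' : (i <= N)%N by do 2 apply: ltnW.
have V1 : S i `<=` V i.+1 by apply: S_V_succ; exact: ltnW.
have V2 : S j `<=` V i.+1 by exact: chain_later_off.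
have [D [cD DO Dc D1 D2]] : exists D, [/\ connected D, D `<=` Om,
    forall w, D w -> rad i.+1 < `|w - ctr i.+1|, S i `<=` D & S j `<=` D].
  apply: (merge_at oOm (rad_gt0 (ltnW iN)) Op).
  - exact: connected_ball.
  - exact: connected_ball.
  - by move=> w /V1[].
  - by move=> w /V2[].
  - by move=> w /V1[].
  - by move=> w /V2[].
  - exact: closureS.
  - exact: closureS.
have DV : D `<=` V i.+1 by move=> w Dw; split; [exact: DO|exact: Dc].
have Uj := chain_later_component ij jN (S_ctr jN).
have DU := U_max cD DV (D2 _ (S_ctr jN)) Uj.
have : ~ U i.+1 (ctr i).
  by apply: chain_not_linked => //; [exact: component_connected|exact: Uy].
by apply; exact/DU/D1/S_ctr.
Qed.

End Chain.

(** * Finiteness of the chain *)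

Section Termination.
Variable R : realType.
Notation C := (R * R)%type.

(* Each square of an infinite chain would meet a fixed compact connected set
   joining its first centre to [y], and the complement of [Om]. *)
Lemma chain_terminates (Om : set C) (y : C) (ctr : nat -> C) (rad : nat -> R) :
  open Om -> connected Om -> bounded_set Om -> Om y ->
  (forall m, 0 < rad m) -> (forall m, ball (ctr m) (rad m) `<=` Om) ->
  (forall m, exists2 z, cball (ctr m) (rad m) z & ~ Om z) ->
  (forall m, rad m < `|y - ctr m|) ->
  (forall m, rad m + rad m.+1 <= `|ctr m.+1 - ctr m|) ->
  (forall m, exists2 p, Om p & cball (ctr m) (rad m) p /\ cball (ctr m.+1) (rad m.+1) p) ->
  (forall m, cball (ctr m.+1) (rad m.+1) y \/ separates Om (ctr m.+1) (rad m.+1) y (ctr m)) ->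
  False.
Proof.
move=> oOm cOm bOm Oy r0 SOm bdry far dis tch sep.
have Octr m : Om (ctr m) by apply: SOm; exact: ballxx.
have [K [cK nK KO Kx Ky]] := linked_connected oOm cOm (@subset_refl _ Om) (Octr 0%N) Oy.
have [d d0 dK] := compact_thicken cK oOm KO.
have later_off i j ij := @chain_later_off _ Om y ctr rad j oOm cOm Oy (fun m _ => r0 m)
  (fun m _ => SOm m) (fun m _ => far m) (fun m _ => dis m) (fun m _ => sep m) i j ij (leqnn j).
have earlier_off i := @chain_earlier_off _ Om y ctr rad i.+1 oOm cOm Oy (fun m _ => r0 m)
  (fun m _ => SOm m) (fun m _ => far m) (fun m _ => dis m) (fun m _ => sep m) i i.+1 (ltnSn i) (leqnn _).
have earlier_component i j ji := @chain_earlier_component _ Om y ctr rad i.+2 oOm cOm Oy (fun m _ => r0 m)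
  (fun m _ => SOm m) (fun m _ => far m) (fun m _ => dis m) (fun m _ => tch m) (fun m _ => sep m) i j ji (leqnn _).
have not_linked i E := @chain_not_linked _ Om y ctr rad i.+2 (fun m _ => far m) (fun m _ => sep m) i E (leqnn _).
(* If [K] missed the closed square [m.+1], then [K] and the component containing the earlier squares
   would join [y] to [ctr m]. So this closed square contains a point of [K] and a point off [Om],
   which are at least [d] apart. *)
have rad_ge m : d / 2 <= rad m.+1.
  have [w Kw wm] : exists2 w, K w & cball (ctr m.+1) (rad m.+1) w.
    apply: contrapT => none.
    have KV : K `<=` off Om (ctr m.+1) (rad m.+1).
      move=> w Kw; split; first exact: KO.
      by rewrite /= ltNge; apply/negP => h; apply: none; exists w.
    pose E := connected_component (off Om (ctr m.+1) (rad m.+1)) (ctr m).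
    have E0 : E (ctr 0%N) by apply: (earlier_component m 0%N) => //; exact: ballxx.
    have cE : connected (K `|` E).
      by apply: connectedU => //; [exists (ctr 0%N)|exact: component_connected].
    apply: (not_linked m _ cE).
    - by rewrite subUset; split => //; exact: connected_component_sub.
    - by left.
    - by right; apply: connected_component_refl; apply: (earlier_off m) => //; exact: ballxx.
  have [z zm zO] := bdry m.+1.
  have : d <= `|z - w|.
    by rewrite leNgt; apply/negP => h; apply: zO; apply: (dK w Kw); rewrite ball_distE.
  have := dist_triangle w z (ctr m.+1).
  rewrite [`|ctr m.+1 - w|]distrC [`|ctr m.+1 - z|]distrC.
  move: wm zm; rewrite /cball /=; lra.
(* Later centres lie off earlier closed squares, so the centres are uniformly spaced, against the
   compactness of a bounded closed ball. *)
have apart i j : (0 < i)%N -> (i < j)%N -> d / 2 < `|ctr j - ctr i|.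
  case: i => // i _ ij.
  have [_ /=] : off Om (ctr i.+1) (rad i.+1) (ctr j).
    by apply: (later_off i.+1 j) => //; exact: ballxx.
  exact: le_lt_trans (rad_ge i).
have [B hB] := bounded_set_norm bOm.
have [|p [_ clp]] := @compact_cball _ 0 B ((fun n => ctr n) @ \oo) _.
  by exists 0%N => // n _; rewrite /= /cball /= subr0; apply: hB.
have d40 : 0 < d / 4 by rewrite divr_gt0.
have close n : exists2 m, (n < m)%N & `|ctr m - p| < d / 4.
  have F : (ctr @ \oo) [set w | exists2 m, (n < m)%N & w = ctr m].
    by exists n.+1 => // m /= nm; exists m.
  have [w [[m nm ->] wp]] := clp _ _ F (nbhsx_ballx p _ d40).
  by exists m => //; move: wp; rewrite ball_distE.
have [i i0 ip] := close 0%N; have [j ij jp] := close i.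
have := apart i j i0 ij; have := dist_triangle (ctr i) (ctr j) p.
rewrite [`|p - ctr i|]distrC [`|p - ctr j|]distrC; lra.
Qed.

Lemma square_ball (c : C) (r : R) : 0 < r -> square (ball c r).
Proof.
move=> r0; exists (c.1 - r), (c.2 - r), (2 * r); split; first by rewrite mulr_gt0.
apply/seteqP; split=> w; rewrite ball_distE /= prod_normE gt_max /= !ltr_distl.
  by move=> /andP[/andP[h1 h2] /andP[h3 h4]]; split; rewrite /= in_itv /=; lra.
move=> []; rewrite /= !in_itv /= => /andP[h1 h2] /andP[h3 h4].
by apply/andP; split; apply/andP; split; lra.
Qed.

Lemma setD_closure_ball (Om : set C) (c : C) (r : R) : 0 < r ->
  Om `\` closure (ball c r) = off Om c r.
Proof.
move=> r0; rewrite closure_ball_cball//; apply/seteqP; split=> w [Ow].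
  by rewrite /cball /= => /negP; rewrite -ltNge.
by rewrite /= ltNge => /negP.
Qed.

End Termination.

Unset Implicit Arguments.

Theorem theorem1p9 (R : realType) (Omega : set (R * R)) (xbar ybar : R * R)
    (Omega_domain : domain Omega)
    (Omega_simply_connected : simply_connected Omega)
    (Omega_bounded : bounded_set Omega)
    (Omega_xbar : Omega xbar) (Omega_ybar : Omega ybar) :
  exists (k : nat) (S : nat -> set (R * R)),
    (0 < k)%N /\
    (forall i : nat, (1 <= i <= k)%N -> square (S i) /\ S i `<=` Omega) /\
    trivIset [set i : nat | (1 <= i <= k)%N] S /\
    (* (i) *)
    (S 1%N xbar /\ closure (S k) ybar) /\
    (* (ii) *)
    ((forall i : nat, (1 <= i <= k - 1)%N ->
        closure (S i) `&` closure (S i.+1) `&` Omega !=set0) /\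
     (forall i j : nat, (1 <= i <= k)%N -> (1 <= j <= k)%N ->
        (1 < `|i - j|)%N ->
        closure (S i) `&` closure (S j) `&` Omega = set0)) /\
    (* (iii) *)
    (forall i : nat, (2 <= i <= k - 1)%N ->
       ~ connected (Omega `\` closure (S i)) /\
       exists C1 C2 : set (R * R),
         [/\ is_component (Omega `\` closure (S i)) C1,
             is_component (Omega `\` closure (S i)) C2,
             C1 <> C2,
             \bigcup_(j in [set j : nat | (1 <= j < i)%N]) S j `<=` C1 &
             \bigcup_(j in [set j : nat | (i < j <= k)%N]) S j `<=` C2]).
Proof.
have [oOm cOm] := Omega_domain.
pose good (X : (R * R) * R) := [/\ 0 < X.2, ball X.1 X.2 `<=` Omega &
  exists2 z, cball X.1 X.2 z & ~ Omega z].
pose next (X Y : (R * R) * R) := [/\ good Y, X.2 + Y.2 <= `|Y.1 - X.1|,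
  exists2 p, Omega p & cball X.1 X.2 p /\ cball Y.1 Y.2 p &
  cball Y.1 Y.2 ybar \/ separates Omega Y.1 Y.2 ybar X.1].
have [r0 good0] : exists r, good (xbar, r).
  have [|r [r0 rO rz _]] := @tangent_ball_max _ Omega xbar 0 oOm Omega_bounded Omega_xbar.
    by rewrite normr0 ler01.
  by exists r; rewrite scaler0 addr0 in rO rz.
(* Outside its domain of use the successor map returns [X] itself, a dummy value. *)
have /choice[f hf] X : exists Y, good X -> X.2 < `|ybar - X.1| -> next X Y.
  have [[[X0 XO [z zX zO]] Xy]|h] := pselect (good X /\ X.2 < `|ybar - X.1|).
    have [q [r [[q0 qO] dis tch bq alt]]] := square_separation oOm cOm Omega_simply_connected
      Omega_bounded X0 XO zX zO Omega_ybar Xy.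
    by exists (q, r).
  by exists X => gX Xy; case: h.
pose X n := iter n f (xbar, r0).
pose ctr n := (X n).1; pose rad n := (X n).2.
pose far n := rad n < `|ybar - ctr n|.
have goodX n : (forall m, (m < n)%N -> far m) -> good (X n).
  elim: n => [//|n IH] h; have gn : good (X n) by apply: IH => m mn; apply: h; exact: ltnW.
  by have [] := hf _ gn (h n (ltnSn n)).
have [n nfar far_lt] : exists2 n, ~~ far n & forall m, (m < n)%N -> far m.
  have [nfar|allfar] := pselect (exists n, ~~ far n).
    case: (ex_minnP nfar) => m nm min; exists m => // i im.
    by apply: contraLR im => h; rewrite -leqNgt; exact: min.
  have fr n : far n by apply: contrapT => /negP h; apply: allfar; exists n.
  have gd n : good (X n) by apply: goodX => m _; exact: fr.
  have nx n : next (X n) (X n.+1) by apply: hf; [exact: gd|exact: fr].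
  by case: (@chain_terminates _ Omega ybar ctr rad oOm cOm Omega_bounded Omega_ybar) => // m;
    case: (gd m) => //; case: (nx m).
have gd m : (m <= n)%N -> good (X m).
  by move=> mn; apply: goodX => i im; apply: far_lt; exact: leq_trans mn.
have rad0 m : (m <= n)%N -> 0 < rad m by move=> /gd[].
have SOm m : (m <= n)%N -> ball (ctr m) (rad m) `<=` Omega by move=> /gd[].
have nx m : (m < n)%N -> next (X m) (X m.+1).
  by move=> mn; apply: hf; [apply: gd; exact: ltnW|exact: far_lt].
have dis m : (m < n)%N -> rad m + rad m.+1 <= `|ctr m.+1 - ctr m| by move=> /nx[].
have tch m : (m < n)%N -> exists2 p, Omega p & cball (ctr m) (rad m) p /\ cball (ctr m.+1) (rad m.+1) p.
  by move=> /nx[].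
have sep m : (m < n)%N -> cball (ctr m.+1) (rad m.+1) ybar \/
    separates Omega (ctr m.+1) (rad m.+1) ybar (ctr m) by move=> /nx[].
have clS m : (m <= n)%N -> closure (ball (ctr m) (rad m)) = cball (ctr m) (rad m).
  by move=> mn; rewrite closure_ball_cball// rad0.
have later := @chain_later_off _ Omega ybar ctr rad n oOm cOm Omega_ybar rad0 SOm far_lt dis sep.
have nonadj := @chain_nonadjacent _ Omega ybar ctr rad n oOm cOm Omega_ybar rad0 SOm far_lt dis sep.
(* The least [n] whose closed square contains [ybar] ends the chain; the statement counts squares
   from 1, the iteration from 0. *)
exists n.+1, (fun i => ball (ctr i.-1) (rad i.-1)); split => //; split; [|split; [|split; [|split; [split|]]]].
- by case=> // i /andP[_ iN]; split; [apply: square_ball; exact: rad0|exact: SOm].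
- have dj i j : (i < j)%N -> (j <= n)%N -> ball (ctr i) (rad i) `&` ball (ctr j) (rad j) !=set0 -> False.
    move=> ij jn [w [wi /(later i j ij jn)[_ /=]]].
    by move: wi; rewrite ball_distE /= => h1 h2; have := lt_trans h1 h2; rewrite ltxx.
  case=> // i [|j] //= iN jN ne; have [ij|ji|->//] := ltngtP i j.
    by case: (dj i j ij jN ne).
  by rewrite setIC in ne; case: (dj j i ji iN ne).
- split; first by apply: ballxx; exact: rad0.
  by rewrite /= clS// /cball /= leNgt.
- case=> // i /andP[_]; rewrite subn1 /= => iN.
  have [p Op [p1 p2]] := tch i iN; exists p.
  by rewrite !clS//; exact: ltnW.
- case=> // i [|j] //= iN jN ij; rewrite !clS//.
  have [ij'|ij'] : (i.+1 < j)%N \/ (j.+1 < i)%N by lia.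
    exact: nonadj.
  by rewrite [X in X `&` _]setIC; exact: nonadj.
(* The separating square is now number [i.+1] of the iteration; the two components are those of
   [ctr i] and of [ybar]. *)
- case=> // -[|i] //; rewrite subn1 /= => iN.
  rewrite setD_closure_ball; last by apply: rad0; exact: ltnW.
  have not_linked := @chain_not_linked _ Omega ybar ctr rad n far_lt sep i.
  have iN' : (i <= n)%N by do 2 apply: ltnW.
  set V := off Omega _ _.
  have Vy : V ybar by split => //; exact: far_lt.
  have Vi : V (ctr i).
    apply: (@chain_earlier_off _ Omega ybar ctr rad n oOm cOm Omega_ybar rad0 SOm far_lt dis sep i i.+1) => //; first exact: ltnW.
    by apply: ballxx; exact: rad0.
  split; first by move=> cV; exact: (not_linked V iN cV).
  exists (connected_component V (ctr i)), (connected_component V ybar); split.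
  + by exists (ctr i).
  + by exists ybar.
  + move=> e; apply: (not_linked (connected_component V ybar) iN).
    * exact: component_connected.
    * exact: connected_component_sub.
    * exact: (connected_component_refl Vy).
    * by rewrite -e; exact: (connected_component_refl Vi).
  + move=> w [[|j] //= ji Sj].
    exact: (@chain_earlier_component _ Omega ybar ctr rad n oOm cOm Omega_ybar rad0 SOm far_lt dis tch sep i j ji iN w Sj).
  + move=> w [[|j] //= /andP[ij jn] Sj].
    exact: (@chain_later_component _ Omega ybar ctr rad n oOm cOm Omega_ybar rad0 SOm far_lt dis sep i.+1 j ij jn w Sj).
Qed.
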